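(* Let $N\ge1$ be an integer, let $0<k_0\le k^0<1$ and $s_0>t_0>0$ be fixed. For each $\varepsilon>0$ let $k=k_\varepsilon$ be a smooth $\varepsilon$-periodic function on $\mathbb{R}$ with minimum $k_0$ and maximum $k^0$, and let $u_0=u_{0,\varepsilon}$ be an admissible function with $u_0'\ge0$ such that $$\sqrt{2Pt_0}\,\Phi\Big(\frac{r}{\sqrt{2Pt_0}}\Big)\le u_0(r)\le \sqrt{2Ps_0}\,\Phi\Big(\frac{r}{\sqrt{2Ps_0}}\Big)$$ in their common domains (for each of the two inequalities, the set of $r$ where both of its sides are defined). Let $u(r,t)$, $0\le r\le\xi(t)$, $t\ge0$, be the unique time-global classical solution of $$u_t=\frac{u_{rr}}{1+u_r^2}+\frac{(N-1)u_r}{r}\ \ (0<r<\xi(t),\ t>0),$$ $$u(\xi(t),t)=\xi(t),\quad u_r(0,t)=0,\quad u_r(\xi(t),t)=k(\xi(t))\ \ (t>0),\qquad u(r,0)=u_0(r).$$ Then for every $C_1>0$ there exist $\varepsilon_0>0$ and $C_2>0$, independent of $\varepsilon$, such that for all $\varepsilon\in(0,\varepsilon_0)$ and all $t\in[0,C_1\varepsilon^{-4/3}]$, $$\sqrt{2P(t+t_0)}\,\Phi\Big(\frac{r}{\sqrt{2P(t+t_0)}}\Big)\le u(r,t)\le \sqrt{2P(t+s_0)}\,\Phi\Big(\frac{r}{\sqrt{2P(t+s_0)}}\Big)+C_2\,\varepsilon^{1/6}$$ in their common domains.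
   Context: $(P,\Phi)$, with $\Phi=\Phi(\cdot;k_0)$, is the slowest self-similar profile: $P>0$ is the unique number for which $$\frac{\varphi''(z)}{1+[\varphi'(z)]^2}=P[\varphi(z)-z\varphi'(z)]-\frac{N-1}{z}\varphi'(z)\ (0<z<1),\qquad \varphi'(0)=0,\ \varphi(1)=1,\ \varphi'(1)=k_0$$ has a solution, and $\Phi\in C^\infty([0,1])$ is that unique solution. Thus $\sqrt{2Pt}\,\Phi(r/\sqrt{2Pt})$ is defined for $0\le r\le\sqrt{2Pt}$. Admissible function (with respect to $k$): $u_0\in C^1([0,\xi(0)])$, $\xi(0)>0$, with $u_0>0$ in $[0,\xi(0)]$, $u_0(\xi(0))=\xi(0)$, $u_0'(0)=0$, $u_0'(\xi(0))=k(\xi(0))$, $|u_0'(r)|<1$. Classical solution: $u,u_r$ are continuous for $0\le r\le\xi(t)$, $t\ge0$; $u_{rr},u_t$ are continuous for $0<r<\xi(t)$, $t>0$; and the equation, boundary and initial conditions hold. *)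

(* Defs.v *)
From Stdlib Require Import Reals Lra.
From Coquelicot Require Import Coquelicot.
Open Scope R_scope.

(* Derivative of [f] at [x] along the set [D]: two-sided at interior points of
   [D], one-sided at the end points of an interval. *)
Definition is_deriv_on (D : R -> Prop) (f : R -> R) (x l : R) : Prop :=
  filterlim (fun y => (f y - f x) / (y - x))
            (within D (locally' x)) (locally l).

Definition segment (a b x : R) : Prop := a <= x <= b.

(* [f] is of class C^1 on [a,b], with derivative [f']. *)
Definition C1_on (a b : R) (f f' : R -> R) : Prop :=
  (forall x, segment a b x -> is_deriv_on (segment a b) f x (f' x)) /\
  continuous_on (segment a b) f'.

(* [d n] is the n-th derivative on [a,b] (one-sided at the end points) of the
   function [f], which is of class C^oo on [a,b]. *)
Definition Cinfty_on (a b : R) (f : R -> R) (d : nat -> R -> R) : Prop :=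
  (forall x, segment a b x -> d 0%nat x = f x) /\
  (forall n x, segment a b x -> is_deriv_on (segment a b) (d n) x (d (S n) x)).

(* (P, Phi) is the self-similar profile for the slope [k0]. Only the values of
   [Phi] on [0,1] matter. *)
Definition profile (N : nat) (k0 P : R) (Phi : R -> R) : Prop :=
  0 < P /\
  exists d : nat -> R -> R,
    Cinfty_on 0 1 Phi d /\
    (forall z, 0 < z < 1 ->
       d 2%nat z / (1 + (d 1%nat z) ^ 2) =
       P * (Phi z - z * d 1%nat z) - (INR N - 1) / z * d 1%nat z) /\
    d 1%nat 0 = 0 /\ Phi 1 = 1 /\ d 1%nat 1 = k0.

(* r |-> sqrt(2Ps) Phi(r / sqrt(2Ps)), meaningful for 0 <= r <= sqrt(2Ps). *)
Definition selfsim (P : R) (Phi : R -> R) (s r : R) : R :=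
  sqrt (2 * P * s) * Phi (r / sqrt (2 * P * s)).

Definition smooth (f : R -> R) : Prop := forall n x, ex_derive_n f n x.

Definition periodic (T : R) (f : R -> R) : Prop := forall x, f (x + T) = f x.

Definition is_minimum (f : R -> R) (m : R) : Prop :=
  (exists x, f x = m) /\ forall x, m <= f x.

Definition is_maximum (f : R -> R) (m : R) : Prop :=
  (exists x, f x = m) /\ forall x, f x <= m.

(* [u0] is admissible with respect to [k], with domain [0,xi0] and
   derivative [du0]. *)
Definition admissible (k : R -> R) (xi0 : R) (u0 du0 : R -> R) : Prop :=
  0 < xi0 /\
  C1_on 0 xi0 u0 du0 /\
  (forall r, segment 0 xi0 r -> 0 < u0 r) /\
  u0 xi0 = xi0 /\ du0 0 = 0 /\ du0 xi0 = k xi0 /\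
  (forall r, segment 0 xi0 r -> Rabs (du0 r) < 1).

(* Space-time domains, a point being the pair (r, t). *)
Definition closed_dom (xi : R -> R) (p : R * R) : Prop :=
  0 <= fst p <= xi (snd p) /\ 0 <= snd p.

Definition open_dom (xi : R -> R) (p : R * R) : Prop :=
  0 < fst p < xi (snd p) /\ 0 < snd p.

(* Time-global classical solution u(r,t), 0 <= r <= xi(t), t >= 0, with
   initial datum [u0]. The free boundary [xi] is a positive continuous curve;
   the values of [u] outside [closed_dom xi] are irrelevant. *)
Definition classical_solution (N : nat) (k u0 : R -> R)
    (xi : R -> R) (u : R -> R -> R) : Prop :=
  continuous_on (fun t => 0 <= t) xi /\
  (forall t, 0 <= t -> 0 < xi t) /\
  exists ur urr ut : R -> R -> R,
    (forall t r, 0 <= t -> segment 0 (xi t) r ->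
       is_deriv_on (segment 0 (xi t)) (fun x => u x t) r (ur r t)) /\
    (forall t r, 0 < t -> 0 < r < xi t ->
       is_derive (fun x => ur x t) r (urr r t) /\
       is_derive (fun s => u r s) t (ut r t)) /\
    continuous_on (closed_dom xi) (fun p => u (fst p) (snd p)) /\
    continuous_on (closed_dom xi) (fun p => ur (fst p) (snd p)) /\
    continuous_on (open_dom xi) (fun p => urr (fst p) (snd p)) /\
    continuous_on (open_dom xi) (fun p => ut (fst p) (snd p)) /\
    (forall t r, 0 < t -> 0 < r < xi t ->
       ut r t = urr r t / (1 + (ur r t) ^ 2) + (INR N - 1) * ur r t / r) /\
    (forall t, 0 < t ->
       u (xi t) t = xi t /\ ur 0 t = 0 /\ ur (xi t) t = k (xi t)) /\
    (forall r, segment 0 (xi 0) r -> u r 0 = u0 r).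

(* Main.v *)
Require Import Defs.
From Stdlib Require Import Reals ZArith Classical Lra Lia Psatz.
From Coquelicot Require Import Coquelicot.
Open Scope R_scope.

(** Both inequalities are comparison arguments. A barrier that lies on one side
    of [u] at time 0 and fails later has a first touching point
    ([first_touch]); there the first and second order conditions contradict the
    differential inequality of the barrier ([supersolution_touch],
    [subsolution_touch]) or one of the boundary conditions.

    Lower bound. The self-similar solution with slope [k0] is a solution whose
    slope at the free boundary is at most [k], hence a subsolution; adding a
    small multiple of [r - C r^2 - (const + M t)] makes all inequalities strict
    ([lower_bound]). As [u] stays above the diagonal ([above_diagonal]), the
    barrier cannot touch [u] at its own free boundary.

    Upper bound. The slope [k] may exceed [k0] nearly everywhere, so a barrier of
    slope near [k0] is not a supersolution at the boundary. But [k = k0] at one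
    radius [X] in each period, and there the boundary can be held: a static
    concave parabola through [(X, X)] with slope [k0 + mu] is a strict
    supersolution near [X], and [u] cannot cross it, since its own slope at [X]
    is only [k0]. The parabola lives in a layer of width [L ~ mu X]. At the
    inner edge of the layer it must dominate the outer barrier
    [V = rho ((1 + delta) Phi(r / rho) - delta)], whose boundary [rho] moves
    from [X] to at most [X + eps] in the meantime. Compared with [V], whose
    slope is [(1 + delta) k0], the parabola gains [mu L ~ mu^2 X] across the
    layer, with [mu = delta k0 / 2], and this must exceed the [eps] by which [V]
    has moved. So it is enough that [delta ~ sqrt (eps / X)]
    ([pinned_boundary]).

    The outer barrier is a strict supersolution as soon as its radius moves
    slightly faster than the self-similar one,
    [rho rho' = P (1 + theta)] with [theta] a fixed multiple of [delta]
    ([stretched_comparison]); this uses that [Phi] is convex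
    ([profile_convex]). With [theta ~ sqrt (eps / R)] and
    [R = sqrt (2 P (t + s0))] the radius gains [rho - R ~ theta R ~ sqrt (eps R)],
    which is at most of order [eps^(1/6)] as long as [R] is at most of order
    [eps^(-2/3)], that is, for [t] at most of order [eps^(-4/3)]. *)

(** * One-sided derivatives and extrema *)

(** Multiplying by [y - x] makes [y = x] admissible, which saves case
    distinctions later. *)
Lemma deriv_on_eps (D : R -> Prop) (f : R -> R) (x l : R) :
  is_deriv_on D f x l ->
  forall e, 0 < e -> exists d, 0 < d /\
    forall y, D y -> Rabs (y - x) < d ->
      Rabs (f y - f x - l * (y - x)) <= e * Rabs (y - x).
Proof.
intros H e He.
assert (Hl : locally l (fun z => Rabs (z - l) < e)).
{ exists (mkposreal e He). intros z Hz. exact Hz. }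
specialize (H _ Hl). unfold filtermap, within, locally' in H.
destruct H as [d Hd]. exists d. split; [apply cond_pos|].
intros y Dy Hy.
destruct (Req_dec y x) as [->|Hne].
{ replace (f x - f x - l * (x - x)) with 0 by ring.
  replace (x - x) with 0 by ring. rewrite Rabs_R0. lra. }
assert (B : ball x d y) by exact Hy.
specialize (Hd y B Hne Dy). simpl in Hd.
replace (f y - f x - l * (y - x)) with (((f y - f x) / (y - x) - l) * (y - x))
  by (field; lra).
rewrite Rabs_mult. apply Rmult_le_compat_r; [apply Rabs_pos|lra].
Qed.

Lemma deriv_on_interior (a b : R) (f : R -> R) (x l : R) :
  a < x < b -> is_deriv_on (segment a b) f x l -> is_derive f x l.
Proof.
intros Hx H. apply is_derive_Reals. intros e He.
destruct (deriv_on_eps _ _ _ _ H (e / 2)) as [d [Hd Hf]]; [lra|].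
assert (Hm : 0 < Rmin d (Rmin (x - a) (b - x))).
{ repeat apply Rmin_glb_lt; lra. }
exists (mkposreal _ Hm). simpl. intros h Hh Hhd.
assert (h1 := Rmin_l d (Rmin (x - a) (b - x))).
assert (h2 := Rmin_r d (Rmin (x - a) (b - x))).
assert (h3 := Rmin_l (x - a) (b - x)).
assert (h4 := Rmin_r (x - a) (b - x)).
assert (Hab : - Rabs h <= h <= Rabs h).
{ split; [|apply Rle_abs]. generalize (Rle_abs (- h)). rewrite Rabs_Ropp. lra. }
specialize (Hf (x + h)).
replace (x + h - x) with h in Hf by ring.
assert (B : Rabs (f (x + h) - f x - l * h) <= e / 2 * Rabs h).
{ apply Hf; [unfold segment; lra | lra]. }
replace ((f (x + h) - f x) / h - l) with ((f (x + h) - f x - l * h) / h)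
  by (field; exact Hh).
unfold Rdiv. rewrite Rabs_mult, Rabs_inv.
assert (Hp : 0 < Rabs h) by (apply Rabs_pos_lt; exact Hh).
apply Rle_lt_trans with (e / 2 * Rabs h * / Rabs h).
{ apply Rmult_le_compat_r; [|exact B]. left. apply Rinv_0_lt_compat. exact Hp. }
rewrite Rmult_assoc, Rinv_r, Rmult_1_r; lra.
Qed.

(** Extending a function by its end values turns one-sided continuity at the end
    points of [[a, b]] into two-sided continuity, as most of the theory requires. *)
Definition clamped (a b : R) (f : R -> R) (x : R) : R := f (Rmax a (Rmin b x)).

Lemma clamped_inside (a b : R) (f : R -> R) (x : R) :
  a <= x <= b -> clamped a b f x = f x.
Proof.
intros H. unfold clamped. rewrite Rmin_right, Rmax_right by lra. reflexivity.
Qed.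

Lemma clamped_continuous (a b : R) (f f' : R -> R) :
  a <= b ->
  (forall x, a <= x <= b -> is_deriv_on (segment a b) f x (f' x)) ->
  forall x, continuity_pt (clamped a b f) x.
Proof.
intros Hab H x e He.
set (c := fun y => Rmax a (Rmin b y)).
assert (Hc : forall y, a <= c y <= b).
{ intro y. unfold c, Rmax, Rmin. repeat destruct (Rle_dec _ _); lra. }
assert (Hlip : forall y, Rabs (c y - c x) <= Rabs (y - x)).
{ intro y. unfold c, Rmax, Rmin. repeat destruct (Rle_dec _ _);
  unfold Rabs; repeat destruct (Rcase_abs _); lra. }
destruct (deriv_on_eps _ _ _ _ (H (c x) (Hc x)) 1) as [d [Hd Hf]]; [lra|].
set (M := 1 + Rabs (f' (c x))).
assert (HM : 0 < M) by (unfold M; generalize (Rabs_pos (f' (c x))); lra).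
exists (Rmin d (e / M)). split.
{ apply Rmin_glb_lt; [exact Hd|]. apply Rdiv_lt_0_compat; assumption. }
intros y [_ Hy]. simpl in Hy |- *. unfold R_dist in *.
change (Rabs (f (c y) - f (c x)) < e).
assert (m1 := Rmin_l d (e / M)). assert (m2 := Rmin_r d (e / M)).
assert (B := Hf (c y) (Hc y)). specialize (Hlip y).
assert (Bd := B ltac:(lra)).
apply Rle_lt_trans with (M * Rabs (c y - c x)).
{ replace (f (c y) - f (c x))
    with ((f (c y) - f (c x) - f' (c x) * (c y - c x)) + f' (c x) * (c y - c x))
    by ring.
  eapply Rle_trans; [apply Rabs_triang|]. rewrite Rabs_mult. unfold M. lra. }
apply Rle_lt_trans with (M * Rabs (y - x)).
{ apply Rmult_le_compat_l; lra. }
apply Rlt_le_trans with (M * (e / M)).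
{ apply Rmult_lt_compat_l; lra. }
right. field. lra.
Qed.

Lemma clamped_derive (a b : R) (f f' : R -> R) (x : R) :
  a < x < b -> is_deriv_on (segment a b) f x (f' x) ->
  is_derive (clamped a b f) x (clamped a b f' x).
Proof.
intros Hx H. rewrite clamped_inside by lra.
apply is_derive_ext_loc with f.
- assert (Hm : 0 < Rmin (x - a) (b - x)) by (apply Rmin_glb_lt; lra).
  exists (mkposreal _ Hm). intros y Hy. symmetry. apply clamped_inside.
  assert (h3 := Rmin_l (x - a) (b - x)). assert (h4 := Rmin_r (x - a) (b - x)).
  assert (Hy' : Rabs (y - x) < Rmin (x - a) (b - x)) by exact Hy.
  apply Rabs_def2 in Hy'. lra.
- apply deriv_on_interior with a b; assumption.
Qed.

Lemma mean_value (f f' : R -> R) (a b : R) :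
  a < b -> (forall x, continuity_pt f x) ->
  (forall x, a < x < b -> is_derive f x (f' x)) ->
  exists c, a < c < b /\ f b - f a = f' c * (b - a).
Proof.
intros Hab Hc Hd.
assert (pr : forall c, a < c < b -> derivable_pt f c).
{ intros c Hcb. exists (f' c). apply is_derive_Reals, Hd, Hcb. }
destruct (MVT f id a b pr (fun c _ => derivable_pt_id c) Hab) as [c [P E]].
- intros; apply Hc.
- intros. apply derivable_continuous_pt, derivable_pt_id.
- exists c. split; [exact P|].
  assert (E1 : derive_pt f c (pr c P) = f' c).
  { apply derive_pt_eq_0, is_derive_Reals, Hd, P. }
  rewrite E1, derive_pt_id in E. unfold id in E. lra.
Qed.

Lemma derive_eps (f : R -> R) (x l : R) :
  is_derive f x l -> forall e, 0 < e -> exists d, 0 < d /\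
    forall y, Rabs (y - x) < d ->
      Rabs (f y - f x - l * (y - x)) <= e * Rabs (y - x).
Proof.
intros H e He. apply is_derive_Reals in H. destruct (H e He) as [d Hd].
exists d. split; [apply cond_pos|]. intros y Hy.
destruct (Req_dec y x) as [->|Hne].
{ replace (f x - f x - l * (x - x)) with 0 by ring.
  replace (x - x) with 0 by ring. rewrite Rabs_R0. lra. }
assert (B := Hd (y - x) ltac:(lra) Hy).
replace (x + (y - x)) with y in B by ring.
replace (f y - f x - l * (y - x)) with (((f y - f x) / (y - x) - l) * (y - x))
  by (field; lra).
rewrite Rabs_mult. apply Rmult_le_compat_r; [apply Rabs_pos|lra].
Qed.

Lemma deriv_on_left_nonpos (D : R -> Prop) (f : R -> R) (x l eta : R) :
  0 < eta -> (forall y, x - eta < y < x -> D y) ->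
  is_deriv_on D f x l ->
  (forall y, x - eta < y < x -> f x <= f y) -> l <= 0.
Proof.
intros He HD H Hf. destruct (Rle_lt_dec l 0) as [|Hl]; [assumption|exfalso].
destruct (deriv_on_eps _ _ _ _ H (l / 2)) as [d [Hd B]]; [lra|].
set (m := Rmin d eta / 2).
assert (m1 := Rmin_l d eta). assert (m2 := Rmin_r d eta).
assert (m0 : 0 < Rmin d eta) by (apply Rmin_glb_lt; lra).
specialize (B (x - m)). specialize (Hf (x - m)). 
replace (x - m - x) with (- m) in B by ring.
rewrite Rabs_Ropp, (Rabs_right m) in B by (unfold m; lra).
assert (B' := B ltac:(apply HD; unfold m; lra) ltac:(unfold m; lra)).
assert (Hf' := Hf ltac:(unfold m; lra)).
apply Rabs_le_between in B'.
assert (0 < l * m) by (apply Rmult_lt_0_compat; unfold m; lra).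
lra.
Qed.

Lemma deriv_on_right_nonneg (D : R -> Prop) (f : R -> R) (x l eta : R) :
  0 < eta -> (forall y, x < y < x + eta -> D y) ->
  is_deriv_on D f x l ->
  (forall y, x < y < x + eta -> f x <= f y) -> 0 <= l.
Proof.
intros He HD H Hf. destruct (Rle_lt_dec 0 l) as [|Hl]; [assumption|exfalso].
destruct (deriv_on_eps _ _ _ _ H (- l / 2)) as [d [Hd B]]; [lra|].
set (m := Rmin d eta / 2).
assert (m1 := Rmin_l d eta). assert (m2 := Rmin_r d eta).
assert (m0 : 0 < Rmin d eta) by (apply Rmin_glb_lt; lra).
specialize (B (x + m)). specialize (Hf (x + m)). 
replace (x + m - x) with (m) in B by ring.
rewrite (Rabs_right m) in B by (unfold m; lra).
assert (B' := B ltac:(apply HD; unfold m; lra) ltac:(unfold m; lra)).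
assert (Hf' := Hf ltac:(unfold m; lra)).
apply Rabs_le_between in B'.
assert (0 < - l * m) by (apply Rmult_lt_0_compat; unfold m; lra).
lra.
Qed.

Lemma derive_deriv_on (D : R -> Prop) (f : R -> R) (x l : R) :
  is_derive f x l -> is_deriv_on D f x l.
Proof.
intros H. intros Q [e HQ]. 
destruct (derive_eps _ _ _ H (e / 2)) as [d [Hd B]].
{ generalize (cond_pos e); lra. }
unfold filtermap, within, locally'.
exists (mkposreal d Hd). intros y Hy Hne _. apply HQ.
assert (B' := B y Hy).
change (Rabs ((f y - f x) / (y - x) - l) < e).
replace ((f y - f x) / (y - x) - l) with ((f y - f x - l * (y - x)) / (y - x))
  by (field; lra).
unfold Rdiv. rewrite Rabs_mult, Rabs_inv.
assert (Hp : 0 < Rabs (y - x)) by (apply Rabs_pos_lt; lra).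
apply Rle_lt_trans with (e / 2 * Rabs (y - x) * / Rabs (y - x)).
{ apply Rmult_le_compat_r; [|exact B']. left. apply Rinv_0_lt_compat. exact Hp. }
rewrite Rmult_assoc, Rinv_r, Rmult_1_r by lra. generalize (cond_pos e); lra.
Qed.

(** If the second derivative were negative, the first one would be negative just
    to the right of [x], and the mean value theorem would give smaller values. *)
Lemma local_min_second_order (f f' : R -> R) (x l eta : R) :
  0 < eta ->
  (forall y, x - eta < y < x + eta -> is_derive f y (f' y)) ->
  is_derive f' x l ->
  (forall y, x - eta < y < x + eta -> f x <= f y) ->
  f' x = 0 /\ 0 <= l.
Proof.
intros He Hf Hf' Hmin.
assert (Hx := derive_deriv_on (fun _ => True) _ _ _ (Hf x ltac:(lra))).
assert (E : f' x = 0).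
{ apply Rle_antisym.
  - apply (deriv_on_left_nonpos _ _ _ _ _ He (fun _ _ => I) Hx).
    intros; apply Hmin; lra.
  - apply (deriv_on_right_nonneg _ _ _ _ _ He (fun _ _ => I) Hx).
    intros; apply Hmin; lra. }
split; [exact E|].
destruct (Rle_lt_dec 0 l) as [|Hl]; [assumption|exfalso].
destruct (derive_eps _ _ _ Hf' (- l / 2)) as [d [Hd B]]; [lra|].
set (m := Rmin d eta / 2).
assert (m1 := Rmin_l d eta). assert (m2 := Rmin_r d eta).
assert (m0 : 0 < Rmin d eta) by (apply Rmin_glb_lt; lra).
assert (Hm : 0 < m < Rmin d eta) by (unfold m; lra).
destruct (mean_value (clamped x (x + m) f) (clamped x (x + m) f') x (x + m))
  as [c [Hc Ec]]; [lra| | |].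
- apply clamped_continuous with f'; [lra|]. intros y Hy.
  apply derive_deriv_on, Hf. lra.
- intros y Hy. apply clamped_derive; [lra|]. apply derive_deriv_on, Hf. lra.
- rewrite !clamped_inside in Ec by lra.
  assert (M := Hmin (x + m) ltac:(lra)).
  assert (Bc := B c). rewrite (Rabs_right (c - x)) in Bc by lra.
  specialize (Bc ltac:(lra)). rewrite E in Bc. apply Rabs_le_between in Bc.
  assert (f' c < 0) by nra. nra.
Qed.

Lemma deriv_on_minus (D : R -> Prop) (f g : R -> R) (x a b : R) :
  is_deriv_on D f x a -> is_deriv_on D g x b ->
  is_deriv_on D (fun y => f y - g y) x (a - b).
Proof.
intros Hf Hg. unfold is_deriv_on.
apply (filterlim_ext (fun y => plus ((f y - f x) / (y - x)) (opp ((g y - g x) / (y - x))))).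
{ intros y. unfold plus, opp, Rdiv. simpl. ring. }
apply (@filterlim_comp_2 _ _ _ _ (within D (locally' x)) (locally a)
    (locally (opp b)) (locally (a - b)) _ (fun y => (f y - f x) / (y - x))
    (fun y => opp ((g y - g x) / (y - x))) plus).
- exact Hf.
- apply (filterlim_comp _ _ _ _ opp _ (locally b)); [exact Hg|].
  apply (filterlim_opp (V := R_NormedModule)).
- apply (filterlim_plus (V := R_NormedModule)).
Qed.

(** * Shape of the self-similar profile *)

(** The profile after clamping to [[0, 1]], with [p] and [q] for its first two
    derivatives. Differentiability of [q] is what allows the equation itself to
    be differentiated. *)
Record extended_profile (N : nat) (k0 P : R) (F p q : R -> R) : Prop := {
  profile_dim : (1 <= N)%nat;
  profile_k0 : 0 < k0 < 1;
  profile_P : 0 < P;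
  profile_cont : forall z, continuity_pt F z;
  profile_slope_cont : forall z, continuity_pt p z;
  profile_derive : forall z, 0 < z < 1 -> is_derive F z (p z);
  profile_slope_derive : forall z, 0 < z < 1 -> is_derive p z (q z);
  profile_curvature_derive : forall z, 0 < z < 1 -> ex_derive q z;
  profile_ode : forall z, 0 < z < 1 ->
    q z / (1 + p z ^ 2) = P * (F z - z * p z) - (INR N - 1) / z * p z;
  profile_slope_0 : p 0 = 0;
  profile_1 : F 1 = 1;
  profile_slope_1 : p 1 = k0 }.

Arguments profile_dim {N k0 P F p q}.
Arguments profile_k0 {N k0 P F p q}.
Arguments profile_P {N k0 P F p q}.
Arguments profile_cont {N k0 P F p q}.
Arguments profile_slope_cont {N k0 P F p q}.
Arguments profile_derive {N k0 P F p q}.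
Arguments profile_slope_derive {N k0 P F p q}.
Arguments profile_curvature_derive {N k0 P F p q}.
Arguments profile_ode {N k0 P F p q}.
Arguments profile_slope_0 {N k0 P F p q}.
Arguments profile_1 {N k0 P F p q}.
Arguments profile_slope_1 {N k0 P F p q}.

Lemma profile_extension (N : nat) (k0 P : R) (Phi : R -> R) :
  (1 <= N)%nat -> 0 < k0 < 1 -> profile N k0 P Phi ->
  exists F p q, extended_profile N k0 P F p q /\
    forall z, 0 <= z <= 1 -> F z = Phi z.
Proof.
intros HN Hk [HP [d [[H0 HD] [Hode [Hp0 [HF1 Hp1]]]]]].
exists (clamped 0 1 (d 0%nat)), (clamped 0 1 (d 1%nat)), (clamped 0 1 (d 2%nat)).
assert (Hc : forall n z, continuity_pt (clamped 0 1 (d n)) z).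
{ intros n z. apply clamped_continuous with (d (S n)); [lra|]. intros; apply HD; assumption. }
assert (Hd : forall n z, 0 < z < 1 ->
  is_derive (clamped 0 1 (d n)) z (clamped 0 1 (d (S n)) z)).
{ intros n z Hz. apply clamped_derive; [exact Hz|]. apply HD. unfold segment; lra. }
split.
- split; try assumption; try (intros; apply Hc); try (intros; apply Hd; assumption).
  + intros z Hz. eexists. apply Hd, Hz.
  + intros z Hz. rewrite !clamped_inside by lra. rewrite H0 by (unfold segment; lra).
    apply Hode, Hz.
  + rewrite clamped_inside by lra. exact Hp0.
  + rewrite clamped_inside by lra. rewrite H0 by (unfold segment; lra). exact HF1.
  + rewrite clamped_inside by lra. exact Hp1.
- intros z Hz. rewrite clamped_inside by lra. apply H0. exact Hz.
Qed.

Section ProfileShape.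
Context {N : nat} {k0 P : R} {F p q : R -> R} (H : extended_profile N k0 P F p q).

(** The derivative of the profile equation. At a critical point of the slope [p]
    its right-hand side is [(N - 1) p / z^2], so that maximum principles apply
    to [p]. *)
Lemma profile_third_order z : 0 < z < 1 ->
  exists q3, is_derive q z q3 /\
   q3 / (1 + p z ^ 2) - 2 * p z * q z ^ 2 / (1 + p z ^ 2) ^ 2 =
   - P * z * q z - (INR N - 1) * (q z / z - p z / z ^ 2).
Proof.
destruct H as [_ _ _ _ _ HF Hp Hq Ho _ _ _]. intros Hz.
destruct (Hq z Hz) as [q3 H3]. exists q3. split; [exact H3|].
assert (Hpos : 0 < 1 + p z ^ 2) by nra.
assert (D1 : is_derive (fun z => q z / (1 + p z ^ 2)) z
   (q3 / (1 + p z ^ 2) - 2 * p z * q z ^ 2 / (1 + p z ^ 2) ^ 2)).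
{ assert (E := is_derive_unique _ _ _ H3). assert (E1 := is_derive_unique _ _ _ (Hp z Hz)).
  auto_derive.
  - repeat split; [exists q3; exact H3 | eexists; apply Hp, Hz|].
    apply Rgt_not_eq. nra.
  - replace (Derive (fun x => q x) z) with q3 by (symmetry; exact E).
    replace (Derive (fun x => p x) z) with (q z) by (symmetry; exact E1).
    field. apply Rgt_not_eq. nra. }
assert (D2 : is_derive (fun z => P * (F z - z * p z) - (INR N - 1) / z * p z) z
   (- P * z * q z - (INR N - 1) * (q z / z - p z / z ^ 2))).
{ assert (E := is_derive_unique _ _ _ (HF z Hz)). assert (E1 := is_derive_unique _ _ _ (Hp z Hz)).
  auto_derive.
  - repeat split; match goal with |- ex_derive (fun x => F x) _ => exists (p z); exact (HF z Hz) | |- ex_derive _ _ => exists (q z); exact (Hp z Hz) | _ => lra end.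
  - replace (Derive (fun x => F x) z) with (p z) by (symmetry; exact E).
    replace (Derive (fun x => p x) z) with (q z) by (symmetry; exact E1).
    field. lra. }
assert (D3 : is_derive (fun z => q z / (1 + p z ^ 2)) z
   (- P * z * q z - (INR N - 1) * (q z / z - p z / z ^ 2))).
{ eapply is_derive_ext_loc; [|exact D2].
  assert (Hm : 0 < Rmin z (1 - z)) by (apply Rmin_glb_lt; lra).
  exists (mkposreal _ Hm). intros y Hy. symmetry. apply Ho.
  assert (h3 := Rmin_l z (1 - z)). assert (h4 := Rmin_r z (1 - z)).
  assert (Hy' : Rabs (y - z) < Rmin z (1 - z)) by exact Hy.
  apply Rabs_def2 in Hy'. lra. }
rewrite <- (is_derive_unique _ _ _ D1). apply is_derive_unique, D3.
Qed.

Lemma dim_minus_one_nonneg : 0 <= INR N - 1.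
Proof. assert (HN := le_INR _ _ (profile_dim H)). simpl in HN. lra. Qed.


(** At a negative interior minimum of [p - b z^2] the two sides of the
    differentiated equation have opposite signs. The correction [b z^2] is there
    for [N = 1], where the right-hand side vanishes at critical points of [p]. *)
Lemma profile_slope_nonneg z : 0 <= z <= 1 -> 0 <= p z.
Proof.
intros Hz1. destruct (Rle_lt_dec 0 (p z)) as [|Hn]; [assumption|exfalso].
pose proof H as [_ Hk0 HP cF cp HF Hp Hq Ho p0 F1 p1].
(* Small enough that the minimum is neither at an end point nor at a point
   where [p] itself is nonnegative. *)
set (b := Rmin (k0 / 2) (- p z / 2)).
assert (b1 := Rmin_l (k0 / 2) (- p z / 2)). assert (b2 := Rmin_r (k0 / 2) (- p z / 2)).
assert (Hb : 0 < b) by (apply Rmin_glb_lt; lra). fold b in b1, b2.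
set (y := fun z => p z - b * z ^ 2).
destruct (continuity_ab_min y 0 1) as [m [Hm Im]]; [lra| |].
{ intros c _. apply continuity_pt_minus; [apply cp|]. reg. }
assert (ym : y m <= y z) by (apply Hm; lra). unfold y in ym.
assert (m2 : 0 <= m ^ 2 <= 1 /\ 0 <= z ^ 2) by (repeat split; nra).
assert (pm : p m < 0) by nra.
assert (Hm01 : 0 < m < 1).
{ split; apply Rnot_le_lt; intro.
  - replace m with 0 in pm by lra. lra.
  - replace m with 1 in pm by lra. lra. }
destruct (profile_third_order m Hm01) as [q3 [D3 E3]].
destruct (local_min_second_order y (fun z => q z - 2 * b * z) m (q3 - 2 * b) (Rmin m (1 - m))) as [E1 E2].
- apply Rmin_glb_lt; lra.
- assert (h3 := Rmin_l m (1 - m)). assert (h4 := Rmin_r m (1 - m)).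
  intros x Hx. assert (Hpx : is_derive p x (q x)) by (apply Hp; lra).
  unfold y. auto_derive; [eexists; exact Hpx|].
  replace (Derive (fun x => p x) x) with (q x) by (symmetry; apply is_derive_unique, Hpx). ring.
- auto_derive; [eexists; exact D3|].
  replace (Derive (fun x => q x) m) with q3 by (symmetry; apply is_derive_unique, D3). ring.
- assert (h3 := Rmin_l m (1 - m)). assert (h4 := Rmin_r m (1 - m)).
  intros x Hx. apply Hm. lra.
- assert (HN' := dim_minus_one_nonneg).
  assert (Eq : q m = 2 * b * m) by lra.
  assert (0 < 1 + p m ^ 2) by nra.
  assert (A1 : 0 <= q3 / (1 + p m ^ 2)) by (apply Rdiv_le_0_compat; lra).
  assert (A2 : 0 <= - (2 * p m * q m ^ 2 / (1 + p m ^ 2) ^ 2)).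
  { replace (- (2 * p m * q m ^ 2 / (1 + p m ^ 2) ^ 2)) with ((2 * - p m * q m ^ 2) / (1 + p m ^ 2) ^ 2)
      by (field; lra).
    apply Rdiv_le_0_compat; [|apply pow_lt; assumption].
    apply Rmult_le_pos; [lra|]. apply pow2_ge_0. }
  assert (A3 : 0 < P * m * q m).
  { rewrite Eq. repeat apply Rmult_lt_0_compat; lra. }
  assert (A4 : 0 <= (INR N - 1) * (q m / m - p m / m ^ 2)).
  { apply Rmult_le_pos; [exact HN'|].
    replace (q m / m - p m / m ^ 2) with (2 * b + (- p m) / m ^ 2) by (rewrite Eq; field; lra).
    assert (0 <= - p m / m ^ 2); [|lra].
    apply Rdiv_le_0_compat; [lra|apply pow_lt; lra]. }
  lra.
Qed.

(** If [p] decreased somewhere, then [p + b z^2] with small [b] would have a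
    positive interior maximum, which the differentiated equation excludes. *)
Lemma profile_convex z : 0 < z < 1 -> 0 <= q z.
Proof.
intros Hz1. destruct (Rle_lt_dec 0 (q z)) as [|Hn]; [assumption|exfalso].
pose proof H as [_ Hk0 HP cF cp HF Hp Hq Ho p0 F1 p1].
(* Keeps the derivative of [p + b z^2] negative at the right end point. *)
set (b := - q z / 4).
assert (Hb : 0 < b) by (unfold b; lra).
set (y := fun z => - p z - b * z ^ 2).
assert (Dy : forall x, 0 < x < 1 -> is_derive y x (- q x - 2 * b * x)).
{ intros x Hx. assert (Hpx : is_derive p x (q x)) by (apply Hp; lra).
  unfold y. auto_derive; [eexists; exact Hpx|].
  replace (Derive (fun x => p x) x) with (q x) by (symmetry; apply is_derive_unique, Hpx). ring. }
destruct (continuity_ab_min y 0 z) as [m [Hm Im]]; [lra| |].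
{ intros c _. apply continuity_pt_minus; [apply continuity_pt_opp, cp|]. reg. }
assert (ym : y m <= y z) by (apply Hm; lra).
assert (pz := profile_slope_nonneg z ltac:(lra)).
assert (Hmz : 0 < m < z).
{ split; apply Rnot_le_lt; intro.
  - replace m with 0 in ym by lra. unfold y in ym. rewrite p0 in ym.
    assert (0 < b * z ^ 2); [|lra]. apply Rmult_lt_0_compat; [lra|apply pow_lt; lra].
  - assert (m = z) by lra. subst m.
    assert (- q z - 2 * b * z <= 0); [|unfold b in *; nra].
    apply (deriv_on_left_nonpos (fun _ => True) y z _ z); try lra.
    + trivial.
    + apply derive_deriv_on, Dy. lra.
    + intros w Hw. apply Hm. lra. }
destruct (profile_third_order m ltac:(lra)) as [q3 [D3 E3]].
destruct (local_min_second_order y (fun z => - q z - 2 * b * z) m (- q3 - 2 * b) (Rmin m (z - m))) as [E1 E2].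
- apply Rmin_glb_lt; lra.
- assert (h3 := Rmin_l m (z - m)). assert (h4 := Rmin_r m (z - m)).
  intros x Hx. apply Dy. lra.
- auto_derive; [eexists; exact D3|].
  replace (Derive (fun x => q x) m) with q3 by (symmetry; apply is_derive_unique, D3). ring.
- assert (h3 := Rmin_l m (z - m)). assert (h4 := Rmin_r m (z - m)).
  intros x Hx. apply Hm. lra.
- assert (HN' := dim_minus_one_nonneg).
  assert (pm := profile_slope_nonneg m ltac:(lra)).
  assert (Eq : q m = - 2 * b * m) by lra.
  assert (0 < 1 + p m ^ 2) by nra.
  assert (A1 : 0 <= - (q3 / (1 + p m ^ 2))).
  { replace (- (q3 / (1 + p m ^ 2))) with ((- q3) / (1 + p m ^ 2)) by (field; lra).
    apply Rdiv_le_0_compat; lra. }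
  assert (A2 : 0 <= 2 * p m * q m ^ 2 / (1 + p m ^ 2) ^ 2).
  { apply Rdiv_le_0_compat; [|apply pow_lt; assumption].
    apply Rmult_le_pos; [lra|]. apply pow2_ge_0. }
  assert (A3 : 0 < - P * m * q m).
  { rewrite Eq. replace (- P * m * (-2 * b * m)) with (P * m * (2 * b * m)) by ring.
    repeat apply Rmult_lt_0_compat; lra. }
  assert (A4 : 0 <= - (INR N - 1) * (q m / m - p m / m ^ 2)).
  { replace (- (INR N - 1) * (q m / m - p m / m ^ 2)) with
      ((INR N - 1) * (2 * b + p m / m ^ 2)) by (rewrite Eq; field; lra).
    apply Rmult_le_pos; [exact HN'|].
    assert (0 <= p m / m ^ 2); [|lra].
    apply Rdiv_le_0_compat; [lra|apply pow_lt; lra]. }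
  lra.
Qed.

Lemma profile_slope_monotone x y : 0 <= x < y -> y <= 1 -> p x <= p y.
Proof.
intros Hx Hy. pose proof H as [_ Hk0 HP cF cp HF Hp Hq Ho p0 F1 p1].
destruct (mean_value p q x y) as [c [Hc E]]; [lra|exact cp|intros; apply Hp; lra|].
assert (Q := profile_convex c ltac:(lra)). nra.
Qed.

Lemma profile_slope_bounds z : 0 <= z <= 1 -> 0 <= p z <= k0.
Proof.
intros Hz. split; [apply profile_slope_nonneg, Hz|].
pose proof H as [_ Hk0 HP cF cp HF Hp Hq Ho p0 F1 p1].
destruct (Req_dec z 1) as [->|]; [lra|].
rewrite <- p1. apply profile_slope_monotone; lra.
Qed.

Lemma profile_increment x y : 0 <= x < y -> y <= 1 ->
  exists c, x < c < y /\ F y - F x = p c * (y - x).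
Proof.
intros Hx Hy. pose proof H as [_ Hk0 HP cF cp HF Hp Hq Ho p0 F1 p1].
apply mean_value; [lra|exact cF|intros; apply HF; lra].
Qed.

(** The first inequality is convexity: the graph lies above its tangent at 1. *)
Lemma profile_above_tangent z : 0 <= z <= 1 -> 1 - k0 * (1 - z) <= F z <= 1.
Proof.
intros Hz. pose proof H as [_ Hk0 HP cF cp HF Hp Hq Ho p0 F1 p1].
destruct (Req_dec z 1) as [->|]; [lra|].
destruct (profile_increment z 1) as [c [Hc E]]; [lra|lra|].
assert (B := profile_slope_bounds c ltac:(lra)). nra.
Qed.

(** The quantity [F - z p] is the normal speed factor of the self-similar
    solution: [rho F (r / rho)] has derivative [rho' (F - z p)] in time. *)
Lemma profile_legendre z : 0 <= z <= 1 -> 1 - k0 <= F z - z * p z <= 1.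
Proof.
pose proof H as [_ Hk0 HP cF cp HF Hp Hq Ho p0 F1 p1].
intros Hz. assert (B := profile_slope_bounds z Hz).
assert (T := profile_above_tangent z Hz). split; nra.
Qed.

(** In the equation the term with [N - 1] only lowers the curvature. *)
Lemma profile_curvature_bound z : 0 < z < 1 -> q z <= 2 * P.
Proof.
intros Hz. pose proof H as [_ Hk0 HP cF cp HF Hp Hq Ho p0 F1 p1].
specialize (Ho z Hz).
assert (B := profile_slope_bounds z ltac:(lra)).
assert (L := profile_legendre z ltac:(lra)).
assert (HN' := dim_minus_one_nonneg).
assert (Hpos : 0 < 1 + p z ^ 2 <= 2) by (split; nra).
assert (A : 0 <= (INR N - 1) / z * p z).
{ apply Rmult_le_pos; [apply Rdiv_le_0_compat; lra|lra]. }
assert (Eq : q z = (P * (F z - z * p z) - (INR N - 1) / z * p z) * (1 + p z ^ 2)).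
{ rewrite <- Ho. field. lra. }
assert (P * (F z - z * p z) <= P) by nra.
rewrite Eq. nra.
Qed.

Lemma profile_slope_lipschitz x y : 0 <= x <= y -> y <= 1 ->
  p y - p x <= 2 * P * (y - x).
Proof.
intros Hx Hy. pose proof H as [_ Hk0 HP cF cp HF Hp Hq Ho p0 F1 p1].
destruct (Req_dec x y) as [->|]; [lra|].
destruct (mean_value p q x y) as [c [Hc E]]; [lra|exact cp|intros; apply Hp; lra|].
assert (Q := profile_curvature_bound c ltac:(lra)). nra.
Qed.

Lemma profile_below_parabola z : 0 <= z <= 1 ->
  F z <= 1 - k0 * (1 - z) + 2 * P * (1 - z) ^ 2.
Proof.
intros Hz. pose proof H as [_ Hk0 HP cF cp HF Hp Hq Ho p0 F1 p1].
destruct (Req_dec z 1) as [->|]; [lra|].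
destruct (profile_increment z 1) as [c [Hc E]]; [lra|lra|].
assert (L := profile_slope_lipschitz c 1 ltac:(lra) ltac:(lra)).
assert (k0 - 2 * P * (1 - z) <= p c) by nra.
assert ((k0 - 2 * P * (1 - z)) * (1 - z) <= p c * (1 - z)) by (apply Rmult_le_compat_r; lra).
nra.
Qed.

Lemma profile_near_origin z : 0 <= z <= 1 -> F 0 <= F z <= F 0 + 2 * P * z ^ 2.
Proof.
intros Hz. pose proof H as [_ Hk0 HP cF cp HF Hp Hq Ho p0 F1 p1].
destruct (Req_dec z 0) as [->|]; [lra|].
destruct (profile_increment 0 z) as [c [Hc E]]; [lra|lra|].
assert (B := profile_slope_bounds c ltac:(lra)).
assert (L := profile_slope_lipschitz 0 c ltac:(lra) ltac:(lra)).
assert (p c <= 2 * P * z) by nra.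
split; nra.
Qed.

(** The derivative of [rho F (r / rho)] in [rho] is [F - z p], between [1 - k0]
    and 1. The proof uses the mean value theorem for [F] only, which covers the
    end points. *)
Lemma profile_dilation r1 r2 r : 0 <= r <= r1 -> 0 < r1 <= r2 ->
  (1 - k0) * (r2 - r1) <= r2 * F (r / r2) - r1 * F (r / r1) <= r2 - r1.
Proof.
pose proof H as [_ Hk0 HP cF cp HF Hp Hq Ho p0 F1 p1].
intros Hr H12.
destruct (Req_dec r1 r2) as [->|]; [lra|].
set (z1 := r / r1). set (z2 := r / r2).
assert (E1 : r = z1 * r1) by (unfold z1; field; lra).
assert (E2 : r = z2 * r2) by (unfold z2; field; lra).
assert (B2 : 0 <= z2) by (apply Rdiv_le_0_compat; lra).
assert (B1 : z1 <= 1) by (apply Rmult_le_reg_r with r1; rewrite <- ?E1; lra).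
assert (B0 : 0 <= z1) by (apply Rdiv_le_0_compat; lra).
assert (B12 : z2 <= z1) by (apply Rmult_le_reg_r with r1; [lra|]; rewrite <- E1, E2; apply Rmult_le_compat_l; lra).
clearbody z1 z2.
assert (T := profile_above_tangent z2 ltac:(lra)).
destruct (Req_dec z1 z2) as [Ez|Hne].
- rewrite Ez. assert (1 - k0 <= F z2) by nra.
  replace (r2 * F z2 - r1 * F z2) with (F z2 * (r2 - r1)) by ring. split; nra.
- destruct (profile_increment z2 z1) as [c [Hc E]]; [lra|lra|].
  assert (B := profile_slope_bounds c ltac:(lra)).
  replace (r2 * F z2 - r1 * F z1) with ((r2 - r1) * (F z2 - z2 * p c)).
  + assert (1 - k0 <= F z2 - z2 * p c <= 1) by (split; nra). split; nra.
  + replace (F z1) with (F z2 + p c * (z1 - z2)) by lra.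
    replace (r1 * (F z2 + p c * (z1 - z2))) with (r1 * F z2 + p c * (z1 * r1 - r1 * z2)) by ring.
    rewrite <- E1, E2. ring.
Qed.
End ProfileShape.

(** * First touching points *)

Lemma continuous_on_eps (D : R -> Prop) (f : R -> R) (x : R) :
  continuous_on D f -> D x ->
  forall e, 0 < e -> exists d, 0 < d /\
    forall y, D y -> Rabs (y - x) < d -> Rabs (f y - f x) < e.
Proof.
intros H Dx e He.
assert (Hl : locally (f x) (fun z => Rabs (z - f x) < e)).
{ exists (mkposreal e He). intros z Hz. exact Hz. }
specialize (H x Dx _ Hl). destruct H as [d Hd]. exists d.
split; [apply cond_pos|]. intros y Dy Hy. apply Hd; [exact Hy|exact Dy].
Qed.

Lemma continuous_on_eps2 (D : R * R -> Prop) (h : R -> R -> R) (r t : R) :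
  continuous_on D (fun pt => h (fst pt) (snd pt)) -> D (r, t) ->
  forall e, 0 < e -> exists d, 0 < d /\
    forall r' t', D (r', t') -> Rabs (r' - r) < d -> Rabs (t' - t) < d ->
      Rabs (h r' t' - h r t) < e.
Proof.
intros H Dx e He.
assert (Hl : locally (h r t) (fun z => Rabs (z - h r t) < e)).
{ exists (mkposreal e He). intros z Hz. exact Hz. }
specialize (H (r, t) Dx _ Hl). destruct H as [d Hd]. exists d.
split; [apply cond_pos|]. intros r' t' Dy H1 H2.
exact (Hd (r', t') (conj H1 H2) Dy).
Qed.

Definition slab (a : R) (ze : R -> R) (pt : R * R) : Prop :=
  a <= fst pt <= ze (snd pt) /\ 0 <= snd pt.

(** First failure of positivity. At the time [ts] itself [h] is nonnegative only
    for [r < ze ts]: a point on the curve [ze] need not be a limit of points of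
    the slab at earlier times. *)
Definition touch (a : R) (ze : R -> R) (h : R -> R -> R) (rs ts : R) : Prop :=
  0 < ts /\ a <= rs <= ze ts /\ h rs ts <= 0 /\
  (forall r t, 0 <= t < ts -> a <= r <= ze t -> 0 < h r t) /\
  (forall r, a <= r < ze ts -> 0 <= h r ts).

(** The infimum of the bad times is attained because the bad points at times
    close to it stay in a bounded region and their set is closed. *)
Lemma first_touch (a T : R) (ze : R -> R) (h : R -> R -> R) :
  continuous_on (fun t => 0 <= t) ze ->
  continuous_on (slab a ze) (fun pt => h (fst pt) (snd pt)) ->
  (forall r, a <= r <= ze 0 -> 0 < h r 0) ->
  (exists r t, 0 <= t <= T /\ a <= r <= ze t /\ h r t <= 0) ->
  exists rs ts, ts <= T /\ touch a ze h rs ts.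
Proof.
intros Cz Ch H0 Hbad.
set (bad := fun r t => 0 <= t <= T /\ a <= r <= ze t /\ h r t <= 0).
destruct (completeness (fun s => exists r, bad r (- s))) as [m [mub mlub]].
{ exists 0. intros s [r [B _]]. lra. }
{ destruct Hbad as [r [t B]]. exists (- t), r. unfold bad.
  rewrite Ropp_involutive. exact B. }
set (ts := - m).
assert (Hlow : forall r t, bad r t -> ts <= t).
{ intros r t B. assert (- t <= m); [|unfold ts; lra]. apply mub.
  exists r. rewrite Ropp_involutive. exact B. }
assert (Hnear : forall e, 0 < e -> exists r t, bad r t /\ t < ts + e).
{ intros e He. apply NNPP. intro C.
  assert (m <= m - e); [|lra]. apply mlub. intros s [r B].
  apply Rnot_lt_le. intro. apply C. exists r, (- s). split; [exact B|unfold ts; lra]. }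
assert (Hts : 0 <= ts <= T).
{ split.
  - assert (m <= 0); [|unfold ts; lra]. apply mlub. intros s [r [B _]]. lra.
  - destruct Hbad as [r [t B]]. assert (X := Hlow _ _ B). destruct B. lra. }
(* The smallest radius at which bad points accumulate as the time decreases
   to [ts]. *)
destruct (continuous_on_eps _ _ ts Cz ltac:(lra) 1 ltac:(lra)) as [d1 [Hd1 Bd1]].
destruct (completeness (fun s => forall e, 0 < e ->
            exists r t, bad r t /\ t < ts + e /\ r <= - s)) as [n [nub nlub]].
{ exists (- a). intros s Hs. destruct (Hs 1 ltac:(lra)) as [r [t [B [_ Hr]]]].
  destruct B as [_ [B _]]. lra. }
{ exists (- (ze ts + 1)). intros e He.
  destruct (Hnear (Rmin e d1)) as [r [t [B Ht]]]; [apply Rmin_glb_lt; lra|].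
  assert (e1 := Rmin_l e d1). assert (e2 := Rmin_r e d1).
  exists r, t. split; [exact B|]. split; [lra|].
  assert (X := Hlow _ _ B). destruct B as [Bt [Br _]].
  specialize (Bd1 t ltac:(lra)). rewrite Rabs_right in Bd1 by lra.
  specialize (Bd1 ltac:(lra)). apply Rabs_def2 in Bd1. lra. }
set (rs := - n).
assert (Hacc : forall e, 0 < e -> exists r t,
  bad r t /\ Rabs (r - rs) < e /\ Rabs (t - ts) < e).
{ intros e He.
  assert (C1 : exists e', 0 < e' /\ forall r t, bad r t -> t < ts + e' -> rs - e / 2 < r).
  { apply NNPP. intro C.
    assert (n + e / 2 <= n); [|lra]. apply nub. intros e' He'.
    apply NNPP. intro C'. apply C. exists e'. split; [exact He'|].
    intros r t B Ht. apply Rnot_le_lt. intro. apply C'. exists r, t.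
    repeat split; try apply B; unfold rs in *; lra. }
  destruct C1 as [e' [He' Be']].
  assert (C2 : exists s, n - e / 2 < s /\ forall e, 0 < e ->
            exists r t, bad r t /\ t < ts + e /\ r <= - s).
  { apply NNPP. intro C. assert (n <= n - e / 2); [|lra].
    apply nlub. intros s Hs. apply Rnot_lt_le. intro. apply C. exists s. split; assumption. }
  destruct C2 as [s [Hs Bs]].
  destruct (Bs (Rmin e e')) as [r [t [B [Ht Hr]]]]; [apply Rmin_glb_lt; lra|].
  assert (e1 := Rmin_l e e'). assert (e2 := Rmin_r e e').
  exists r, t. split; [exact B|]. specialize (Be' r t B ltac:(lra)).
  assert (X := Hlow _ _ B).
  split; apply Rabs_def1; unfold rs in *; lra. }
assert (Hdom : a <= rs <= ze ts).
{ split; apply Rnot_lt_le; intro C.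
  - destruct (Hacc (a - rs)) as [r [t [B [Hr _]]]]; [lra|].
    destruct B as [_ [B _]]. apply Rabs_def2 in Hr. lra.
  - destruct (continuous_on_eps _ _ ts Cz ltac:(lra) ((rs - ze ts) / 2) ltac:(lra))
      as [d [Hd Bd]].
    destruct (Hacc (Rmin d ((rs - ze ts) / 2))) as [r [t [B [Hr Ht]]]].
    { apply Rmin_glb_lt; lra. }
    assert (e1 := Rmin_l d ((rs - ze ts) / 2)). assert (e2 := Rmin_r d ((rs - ze ts) / 2)).
    destruct B as [Bt [B _]]. specialize (Bd t ltac:(lra) ltac:(lra)).
    apply Rabs_def2 in Hr. apply Rabs_def2 in Bd. lra. }
assert (Hle : h rs ts <= 0).
{ apply Rnot_lt_le. intro C.
  destruct (continuous_on_eps2 _ _ rs ts Ch) with (e := h rs ts) as [d [Hd Bd]].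
  { split; simpl; lra. } { exact C. }
  destruct (Hacc d Hd) as [r [t [B [Hr Ht]]]].
  destruct B as [Bt [Br Bh]].
  specialize (Bd r t ltac:(split; simpl; lra) Hr Ht). apply Rabs_def2 in Bd. lra. }
assert (Hpos : 0 < ts).
{ apply Rnot_le_lt. intro C. assert (E : ts = 0) by lra. rewrite E in *.
  specialize (H0 rs Hdom). lra. }
assert (Hbefore : forall r t, 0 <= t < ts -> a <= r <= ze t -> 0 < h r t).
{ intros r t Ht Hr. apply Rnot_le_lt. intro C.
  assert (ts <= t); [|lra]. apply (Hlow r). split; [lra|]. split; assumption. }
exists rs, ts. split; [lra|]. do 4 (split; [assumption|]).
intros r Hr. apply Rnot_lt_le. intro C.
destruct (continuous_on_eps2 _ _ r ts Ch) with (e := - h r ts) as [d [Hd Bd]].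
{ split; simpl; lra. } { lra. }
destruct (continuous_on_eps _ _ ts Cz ltac:(lra) (ze ts - r) ltac:(lra)) as [d' [Hd' Bd']].
set (mm := Rmin ts (Rmin d d') / 2).
assert (0 < Rmin ts (Rmin d d')) by (repeat apply Rmin_glb_lt; lra).
assert (e1 := Rmin_l ts (Rmin d d')). assert (e2 := Rmin_r ts (Rmin d d')).
assert (e3 := Rmin_l d d'). assert (e4 := Rmin_r d d').
assert (Hmm : 0 < mm < Rmin ts (Rmin d d')) by (unfold mm; lra).
assert (Hab : Rabs (ts - mm - ts) = mm).
{ replace (ts - mm - ts) with (- mm) by ring. rewrite Rabs_Ropp, Rabs_right; lra. }
specialize (Bd' (ts - mm) ltac:(lra) ltac:(lra)). apply Rabs_def2 in Bd'.
assert (Dm : a <= r <= ze (ts - mm)) by lra.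
specialize (Hbefore r (ts - mm) ltac:(lra) Dm).
specialize (Bd r (ts - mm)). rewrite Hab in Bd.
replace (r - r) with 0 in Bd by ring. rewrite Rabs_R0 in Bd.
specialize (Bd ltac:(split; simpl; lra) Hd ltac:(lra)).
apply Rabs_def2 in Bd. lra.
Qed.

Lemma positive_unless_touch (a T : R) (ze : R -> R) (h : R -> R -> R) :
  continuous_on (fun t => 0 <= t) ze ->
  continuous_on (slab a ze) (fun pt => h (fst pt) (snd pt)) ->
  (forall r, a <= r <= ze 0 -> 0 < h r 0) ->
  (forall rs ts, ts <= T -> touch a ze h rs ts -> False) ->
  forall r t, 0 <= t <= T -> a <= r <= ze t -> 0 < h r t.
Proof.
intros Cz Ch H0 Hno r t Ht Hr. apply Rnot_le_lt. intro C.
destruct (first_touch a T ze h Cz Ch H0) as [rs [ts [B1 B2]]].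
{ exists r, t. repeat split; lra. }
exact (Hno rs ts B1 B2).
Qed.

Lemma touch_derivatives (a : R) (ze : R -> R) (h : R -> R -> R) (hr : R -> R)
    (rs ts hrr ht : R) :
  continuous_on (fun t => 0 <= t) ze ->
  touch a ze h rs ts -> a < rs < ze ts ->
  (forall r, a < r < ze ts -> is_derive (fun x => h x ts) r (hr r)) ->
  is_derive hr rs hrr -> is_derive (fun t => h rs t) ts ht ->
  hr rs = 0 /\ 0 <= hrr /\ ht <= 0.
Proof.
intros Cz [Hts [_ [Hle [Hb Ha]]]] Hrs Dr Drr Dt.
assert (E : h rs ts = 0) by (apply Rle_antisym; [exact Hle|apply Ha; lra]).
destruct (local_min_second_order (fun x => h x ts) hr rs hrr (Rmin (rs - a) (ze ts - rs)))
  as [E1 E2].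
- apply Rmin_glb_lt; lra.
- assert (m1 := Rmin_l (rs - a) (ze ts - rs)). assert (m2 := Rmin_r (rs - a) (ze ts - rs)).
  intros y Hy. apply Dr. lra.
- exact Drr.
- assert (m1 := Rmin_l (rs - a) (ze ts - rs)). assert (m2 := Rmin_r (rs - a) (ze ts - rs)).
  intros y Hy. rewrite E. apply Ha. lra.
- split; [exact E1|]. split; [exact E2|].
  destruct (continuous_on_eps _ _ ts Cz ltac:(lra) (ze ts - rs) ltac:(lra)) as [d [Hd Bd]].
  assert (m1 := Rmin_l ts d). assert (m2 := Rmin_r ts d).
  apply (deriv_on_left_nonpos (fun _ => True) (fun t => h rs t) ts ht (Rmin ts d)).
  + apply Rmin_glb_lt; lra.
  + trivial.
  + apply derive_deriv_on, Dt.
  + intros t Ht. rewrite E. left. apply Hb; [lra|].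
    specialize (Bd t ltac:(lra)). rewrite Rabs_left in Bd by lra.
    specialize (Bd ltac:(lra)). apply Rabs_def2 in Bd. lra.
Qed.

(** Excludes touching on the axis: a barrier with nonzero slope at [r = 0] cannot
    touch a function that is flat there. *)
Lemma flat_at_origin (X : R) (f : R -> R) (b C : R) :
  is_deriv_on (segment 0 X) f 0 0 -> 0 < X -> 0 < b -> 0 <= C ->
  exists r, 0 < r < X /\ Rabs (f r - f 0) < b * r - C * r ^ 2.
Proof.
intros H HX Hb HC.
destruct (deriv_on_eps _ _ _ _ H (b / 4)) as [d [Hd B]]; [lra|].
set (r0 := Rmin d (Rmin X (b / (C + 1)))).
assert (r1 := Rmin_l d (Rmin X (b / (C + 1)))). assert (r2 := Rmin_r d (Rmin X (b / (C + 1)))).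
assert (r3 := Rmin_l X (b / (C + 1))). assert (r4 := Rmin_r X (b / (C + 1))).
assert (Hq : 0 < b / (C + 1)) by (apply Rdiv_lt_0_compat; lra).
assert (Hr0 : 0 < r0) by (repeat apply Rmin_glb_lt; lra).
fold r0 in r1, r2.
exists (r0 / 2). split; [lra|].
specialize (B (r0 / 2)). rewrite !Rminus_0_r in B.
rewrite (Rabs_right (r0 / 2)) in B by lra.
specialize (B ltac:(unfold segment; lra) ltac:(lra)).
rewrite Rmult_0_l, Rminus_0_r in B.
assert (K : C * r0 <= b).
{ assert ((C + 1) * r0 <= (C + 1) * (b / (C + 1))) by (apply Rmult_le_compat_l; lra).
  replace ((C + 1) * (b / (C + 1))) with b in H0 by (field; lra). lra. }
assert (C * (r0 / 2) ^ 2 <= b * r0 / 4).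
{ replace (C * (r0 / 2) ^ 2) with (C * r0 * r0 / 4) by field. nra. }
nra.
Qed.

Record solution (N : nat) (k u0 xi : R -> R) (u ur urr ut : R -> R -> R) : Prop := {
  sol_xi : continuous_on (fun t => 0 <= t) xi;
  sol_pos : forall t, 0 <= t -> 0 < xi t;
  sol_r : forall t r, 0 <= t -> segment 0 (xi t) r ->
    is_deriv_on (segment 0 (xi t)) (fun x => u x t) r (ur r t);
  sol_rr : forall t r, 0 < t -> 0 < r < xi t ->
    is_derive (fun x => ur x t) r (urr r t);
  sol_t : forall t r, 0 < t -> 0 < r < xi t ->
    is_derive (fun s => u r s) t (ut r t);
  sol_cont : continuous_on (closed_dom xi) (fun p => u (fst p) (snd p));
  sol_pde : forall t r, 0 < t -> 0 < r < xi t ->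
    ut r t = urr r t / (1 + (ur r t) ^ 2) + (INR N - 1) * ur r t / r;
  sol_bdry : forall t, 0 < t -> u (xi t) t = xi t;
  sol_axis : forall t, 0 < t -> ur 0 t = 0;
  sol_slope : forall t, 0 < t -> ur (xi t) t = k (xi t);
  sol_init : forall r, segment 0 (xi 0) r -> u r 0 = u0 r }.

Arguments sol_xi {N k u0 xi u ur urr ut}.
Arguments sol_pos {N k u0 xi u ur urr ut}.
Arguments sol_r {N k u0 xi u ur urr ut}.
Arguments sol_rr {N k u0 xi u ur urr ut}.
Arguments sol_t {N k u0 xi u ur urr ut}.
Arguments sol_cont {N k u0 xi u ur urr ut}.
Arguments sol_pde {N k u0 xi u ur urr ut}.
Arguments sol_bdry {N k u0 xi u ur urr ut}.
Arguments sol_axis {N k u0 xi u ur urr ut}.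
Arguments sol_slope {N k u0 xi u ur urr ut}.
Arguments sol_init {N k u0 xi u ur urr ut}.

Lemma classical_solution_data N k u0 xi u :
  classical_solution N k u0 xi u ->
  exists ur urr ut, solution N k u0 xi u ur urr ut.
Proof.
intros [H1 [H2 [ur [urr [ut [H3 [H4 [H5 [H6 [H7 [H8 [H9 [H10 H11]]]]]]]]]]]]].
exists ur, urr, ut. split; try assumption; intros; try (apply H4; assumption); try (apply H10; assumption).
Qed.

Lemma continuous_on_minus_slab (a : R) (ze xi : R -> R) (u w : R -> R -> R) :
  0 <= a -> (forall t, 0 <= t -> ze t <= xi t) ->
  continuous_on (closed_dom xi) (fun p => u (fst p) (snd p)) ->
  (forall r t, 0 <= t -> continuous (fun p : R * R => w (fst p) (snd p)) (r, t)) ->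
  continuous_on (slab a ze) (fun p => w (fst p) (snd p) - u (fst p) (snd p)) /\
  continuous_on (slab a ze) (fun p => u (fst p) (snd p) - w (fst p) (snd p)).
Proof.
intros Ha Hz Hu Hw.
assert (Su : continuous_on (slab a ze) (fun p => u (fst p) (snd p))).
{ apply continuous_on_subset with (closed_dom xi); [|exact Hu].
  intros [r t] [B1 B2]. simpl in *. specialize (Hz t B2). split; simpl; lra. }
assert (Sw : continuous_on (slab a ze) (fun p => w (fst p) (snd p))).
{ apply continuous_on_forall. intros [r t] [_ B]. apply Hw, B. }
assert (Hm : forall f g : R * R -> R, continuous_on (slab a ze) f ->
   continuous_on (slab a ze) g -> continuous_on (slab a ze) (fun p => f p - g p)).
{ intros f g Hf Hg x Dx.
  apply (@filterlim_comp_2 _ _ _ _ (within (slab a ze) (locally x)) (locally (f x))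
    (locally (opp (g x))) (locally (f x - g x)) _ f (fun p => opp (g p)) plus).
  - apply Hf, Dx.
  - apply (filterlim_comp _ _ _ g opp _ (locally (g x))); [apply Hg, Dx|].
    apply (filterlim_opp (V := R_NormedModule)).
  - apply (filterlim_plus (V := R_NormedModule)). }
split; apply Hm; assumption.
Qed.

Section Touching.
Variables (N : nat) (k u0 xi : R -> R) (u ur urr ut w : R -> R -> R).
Variables (a : R) (ze wr : R -> R) (rs ts wrr wt : R).
Hypothesis sol : solution N k u0 xi u ur urr ut.
Hypothesis Cz : continuous_on (fun t => 0 <= t) ze.
Hypothesis Ha : 0 <= a.
Hypothesis Hz : ze ts <= xi ts.
Hypothesis Hrs : a < rs < ze ts.
Hypothesis Dr : forall r, a < r < ze ts -> is_derive (fun x => w x ts) r (wr r).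
Hypothesis Drr : is_derive wr rs wrr.
Hypothesis Dt : is_derive (fun t => w rs t) ts wt.

(** A barrier touching [u] from above violates any strict supersolution
    inequality. *)
Lemma supersolution_touch :
  touch a ze (fun r t => w r t - u r t) rs ts ->
  wt <= wrr / (1 + wr rs ^ 2) + (INR N - 1) * wr rs / rs.
Proof.
intros Ht. assert (Hts : 0 < ts) by apply Ht.
destruct (touch_derivatives a ze _ (fun r => wr r - ur r ts) rs ts
  (wrr - urr rs ts) (wt - ut rs ts) Cz Ht Hrs) as [E1 [E2 E3]].
- intros r Hr. apply (is_derive_minus (V := R_NormedModule)); [apply Dr, Hr|].
  apply deriv_on_interior with 0 (xi ts); [lra|]. apply (sol_r sol); unfold segment; lra.
- apply (is_derive_minus (V := R_NormedModule)); [exact Drr|]. apply (sol_rr sol); lra.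
- apply (is_derive_minus (V := R_NormedModule)); [exact Dt|]. apply (sol_t sol); lra.
- assert (Epde := sol_pde sol ts rs Hts ltac:(lra)).
  replace (ur rs ts) with (wr rs) in Epde by lra.
  assert (Hp : 0 < 1 + wr rs ^ 2) by nra.
  assert (urr rs ts / (1 + wr rs ^ 2) <= wrr / (1 + wr rs ^ 2)).
  { apply Rmult_le_compat_r; [left; apply Rinv_0_lt_compat, Hp|lra]. }
  lra.
Qed.

Lemma subsolution_touch :
  touch a ze (fun r t => u r t - w r t) rs ts ->
  wrr / (1 + wr rs ^ 2) + (INR N - 1) * wr rs / rs <= wt.
Proof.
intros Ht. assert (Hts : 0 < ts) by apply Ht.
destruct (touch_derivatives a ze _ (fun r => ur r ts - wr r) rs ts
  (urr rs ts - wrr) (ut rs ts - wt) Cz Ht Hrs) as [E1 [E2 E3]].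
- intros r Hr. apply (is_derive_minus (V := R_NormedModule)); [|apply Dr, Hr].
  apply deriv_on_interior with 0 (xi ts); [lra|]. apply (sol_r sol); unfold segment; lra.
- apply (is_derive_minus (V := R_NormedModule)); [|exact Drr]. apply (sol_rr sol); lra.
- apply (is_derive_minus (V := R_NormedModule)); [|exact Dt]. apply (sol_t sol); lra.
- assert (Epde := sol_pde sol ts rs Hts ltac:(lra)).
  replace (ur rs ts) with (wr rs) in Epde by lra.
  assert (Hp : 0 < 1 + wr rs ^ 2) by nra.
  assert (wrr / (1 + wr rs ^ 2) <= urr rs ts / (1 + wr rs ^ 2)).
  { apply Rmult_le_compat_r; [left; apply Rinv_0_lt_compat, Hp|lra]. }
  lra.
Qed.
End Touching.

(** * Dilated profiles *)

Definition dilate (F : R -> R) (rho r : R) : R := rho * F (r / rho).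

Lemma ratio_inside r rho : 0 < r < rho -> 0 < r / rho < 1.
Proof.
intros H. split; [apply Rdiv_lt_0_compat; lra|].
apply Rmult_lt_reg_r with rho; [lra|]. replace (r / rho * rho) with r by (field; lra). lra.
Qed.

Lemma ratio_inside_closed r rho : 0 <= r <= rho -> 0 < rho -> 0 <= r / rho <= 1.
Proof.
intros H H0. split; [apply Rdiv_le_0_compat; lra|].
apply Rmult_le_reg_r with rho; [lra|]. replace (r / rho * rho) with r by (field; lra). lra.
Qed.

Lemma dilate_derive_r (F p q : R -> R) (rho r : R) :
  (forall z, 0 < z < 1 -> is_derive F z (p z)) ->
  (forall z, 0 < z < 1 -> is_derive p z (q z)) -> 0 < r < rho ->
  is_derive (dilate F rho) r (p (r / rho)) /\
  is_derive (fun x => p (x / rho)) r (q (r / rho) / rho).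
Proof.
intros HF Hp Hr. assert (Hz := ratio_inside r rho Hr).
assert (DF := HF _ Hz). assert (Dp := Hp _ Hz).
split.
- unfold dilate. auto_derive.
  + exists (p (r / rho)). exact DF.
  + replace (Derive (fun x => F x) (r * / rho)) with (p (r / rho))
      by (symmetry; apply is_derive_unique, DF). field. lra.
- auto_derive.
  + exists (q (r / rho)). exact Dp.
  + replace (Derive (fun x => p x) (r * / rho)) with (q (r / rho))
      by (symmetry; apply is_derive_unique, Dp). field. lra.
Qed.

Lemma dilate_derive_t (F p rho : R -> R) (rho' r t : R) :
  (forall z, 0 < z < 1 -> is_derive F z (p z)) -> 0 < r < rho t ->
  is_derive rho t rho' ->
  is_derive (fun s => dilate F (rho s) r) t
    (rho' * (F (r / rho t) - r / rho t * p (r / rho t))).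
Proof.
intros HF Hr Drho. assert (Hz := ratio_inside r (rho t) Hr).
assert (DF := HF _ Hz). unfold dilate. auto_derive.
- repeat split; [exists rho'; exact Drho|exists (p (r / rho t)); exact DF|
    exists rho'; exact Drho|lra].
- replace (Derive (fun x => F x) (r * / rho t)) with (p (r / rho t))
      by (symmetry; apply is_derive_unique, DF).
  replace (Derive (fun x => rho x) t) with rho' by (symmetry; apply is_derive_unique, Drho).
  unfold Rdiv. field. lra.
Qed.

Lemma continuous_of_pt f x : continuity_pt f x -> continuous f x.
Proof. apply continuity_pt_filterlim. Qed.

Lemma continuous_time (f : R -> R) (r t : R) :
  continuous f t -> continuous (fun p : R * R => f (snd p)) (r, t).
Proof. intros H. apply (continuous_comp snd f); [apply continuous_snd|exact H]. Qed.

Lemma dilate_continuous F (rho : R -> R) r t :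
  (forall z, continuity_pt F z) -> continuous rho t -> 0 < rho t ->
  continuous (fun p : R * R => dilate F (rho (snd p)) (fst p)) (r, t).
Proof.
intros HF Hrho Hpos. unfold dilate.
apply (continuous_mult (K := R_AbsRing)); [apply continuous_time, Hrho|].
apply (continuous_comp (fun p : R * R => fst p / rho (snd p)) F);
  [|apply continuous_of_pt, HF].
apply (continuous_mult (K := R_AbsRing)); [apply continuous_fst|].
apply (continuous_comp (fun p : R * R => rho (snd p)) Rinv).
- apply continuous_time, Hrho.
- apply continuous_Rinv. simpl. lra.
Qed.

Definition radius (P s : R) : R := sqrt (2 * P * s).

Lemma radius_pos P s : 0 < P -> 0 < s -> 0 < radius P s.
Proof. intros. apply sqrt_lt_R0. apply Rmult_lt_0_compat; lra. Qed.

Lemma radius_sqr P s : 0 < P -> 0 < s -> radius P s * radius P s = 2 * P * s.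
Proof. intros. apply sqrt_sqrt. apply Rmult_le_pos; lra. Qed.

Lemma radius_derive P (sigma : R -> R) (sigma' t : R) : 0 < P -> 0 < sigma t ->
  is_derive sigma t sigma' ->
  is_derive (fun t => radius P (sigma t)) t (P * sigma' / radius P (sigma t)).
Proof.
intros HP Hs D. unfold radius. auto_derive.
- split; [exists sigma'; exact D|]. split; [|trivial].
  apply Rmult_lt_0_compat; lra.
- replace (Derive (fun x => sigma x) t) with sigma' by (symmetry; apply is_derive_unique, D).
  field. apply Rgt_not_eq, sqrt_lt_R0, Rmult_lt_0_compat; lra.
Qed.

Lemma radius_monotone P s1 s2 : 0 < P -> s1 <= s2 -> radius P s1 <= radius P s2.
Proof. intros. apply sqrt_le_1_alt. apply Rmult_le_compat_l; lra. Qed.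

(** Controls the quasilinear coefficient when the slope of a barrier is
    perturbed. *)
Lemma inverse_one_plus_square x y :
  Rabs (/ (1 + x ^ 2) - / (1 + y ^ 2)) <= Rabs (x - y).
Proof.
assert (Hx : 0 < 1 + x ^ 2) by nra. assert (Hy : 0 < 1 + y ^ 2) by nra.
replace (/ (1 + x ^ 2) - / (1 + y ^ 2))
  with ((x - y) * (- (x + y) / ((1 + x ^ 2) * (1 + y ^ 2)))) by (field; lra).
rewrite Rabs_mult. rewrite <- (Rmult_1_r (Rabs (x - y))) at 2.
apply Rmult_le_compat_l; [apply Rabs_pos|].
assert (Hxy : 0 < (1 + x ^ 2) * (1 + y ^ 2)) by (apply Rmult_lt_0_compat; lra).
assert (Hs : - ((1 + x ^ 2) * (1 + y ^ 2)) <= - (x + y) <= (1 + x ^ 2) * (1 + y ^ 2)).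
{ assert (0 <= x ^ 2 * y ^ 2) by (apply Rmult_le_pos; nra).
  assert (A1 := pow2_ge_0 (x + 1 / 2)). assert (A2 := pow2_ge_0 (y + 1 / 2)).
  assert (A3 := pow2_ge_0 (x - 1 / 2)). assert (A4 := pow2_ge_0 (y - 1 / 2)). split; lra. }
apply Rabs_le. split.
- apply Rmult_le_reg_r with ((1 + x ^ 2) * (1 + y ^ 2)); [lra|].
  replace (- (x + y) / ((1 + x ^ 2) * (1 + y ^ 2)) * ((1 + x ^ 2) * (1 + y ^ 2)))
    with (- (x + y)) by (field; lra). lra.
- apply Rmult_le_reg_r with ((1 + x ^ 2) * (1 + y ^ 2)); [lra|].
  replace (- (x + y) / ((1 + x ^ 2) * (1 + y ^ 2)) * ((1 + x ^ 2) * (1 + y ^ 2)))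
    with (- (x + y)) by (field; lra). lra.
Qed.

(** * Lower bound *)

Lemma initial_above_diagonal k xi0 u0 du0 r :
  admissible k xi0 u0 du0 -> 0 <= r < xi0 -> r < u0 r.
Proof.
intros [Hxi [[HC _] [_ [Hend [_ [_ Hd]]]]]] Hr.
destruct (mean_value (clamped 0 xi0 u0) (clamped 0 xi0 du0) r xi0) as [c [Hc E]].
- lra.
- apply clamped_continuous with du0; [lra|]. intros; apply HC; assumption.
- intros x Hx. apply clamped_derive; [lra|]. apply HC. unfold segment; lra.
- rewrite !clamped_inside in E by lra. rewrite Hend in E.
  assert (B := Hd c ltac:(unfold segment; lra)). apply Rabs_def2 in B. nra.
Qed.

(** The diagonal is a stationary subsolution because [(N - 1) / r >= 0], and [u]
    meets it on the free boundary. Lowering it by [b (1 + t)] makes the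
    comparison strict in both places. *)
Lemma above_diagonal N k u0 du0 xi u ur urr ut t r :
  (1 <= N)%nat -> solution N k u0 xi u ur urr ut ->
  admissible k (xi 0) u0 du0 ->
  0 <= t -> 0 <= r <= xi t -> r <= u r t.
Proof.
intros HN sol adm Ht Hr. apply le_INR in HN. simpl in HN.
apply Rnot_lt_le. intro C.
set (b := (r - u r t) / (1 + t)).
assert (Hb : 0 < b) by (apply Rdiv_lt_0_compat; lra).
set (w := fun r t => r - b * (1 + t)).
assert (Cz := sol_xi sol).
assert (Hpos : 0 < u r t - w r t).
{ apply (positive_unless_touch 0 t xi (fun r t => u r t - w r t)); try lra; try exact Cz.
  - apply (continuous_on_minus_slab 0 xi xi); try lra.
    + intros; lra.
    + apply (sol_cont sol).
    + intros x s Hs. unfold w.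
      apply (continuous_minus (V := R_NormedModule)); [apply continuous_fst|].
      apply (continuous_mult (K := R_AbsRing)); [apply continuous_const|].
      apply (continuous_plus (V := R_NormedModule)); [apply continuous_const|apply continuous_snd].
  - intros x Hx. rewrite (sol_init sol) by exact Hx. unfold w.
    destruct (Req_dec x (xi 0)) as [->|].
    + replace (u0 (xi 0)) with (xi 0) by (symmetry; apply adm). lra.
    + assert (X := initial_above_diagonal _ _ _ _ x adm ltac:(lra)). lra.
  - intros rs ts Hts Htouch. pose proof Htouch as [P1 [P2 [P3 [P4 P5]]]].
    assert (Hbt : 0 < b * (1 + ts)) by (apply Rmult_lt_0_compat; lra).
    assert (Hxi := sol_pos sol ts ltac:(lra)).
    unfold w in P3, P5.
    destruct (Req_dec rs (xi ts)) as [E|Hrx].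
    { rewrite E, (sol_bdry sol) in P3 by lra. lra. }
    destruct (Req_dec rs 0) as [E|Hr0].
    { subst rs. assert (Dr := sol_r sol ts 0 ltac:(lra) ltac:(unfold segment; lra)).
      rewrite (sol_axis sol) in Dr by lra.
      destruct (flat_at_origin _ _ 1 0 Dr Hxi ltac:(lra) ltac:(lra)) as [x [Hx Bx]].
      specialize (P5 x ltac:(lra)). apply Rabs_def2 in Bx. lra. }
    assert (A : 0 / (1 + 1 ^ 2) + (INR N - 1) * 1 / rs <= - b).
    { apply (subsolution_touch N k u0 xi u ur urr ut w 0 xi (fun _ => 1) rs ts 0 (- b) sol Cz); try lra.
      - intros x Hx. unfold w. auto_derive; [trivial|ring].
      - auto_derive; trivial.
      - unfold w. auto_derive; [trivial|ring].
      - exact Htouch. }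
    assert (0 <= (INR N - 1) * 1 / rs) by (apply Rdiv_le_0_compat; lra).
    lra. }
unfold w in Hpos. replace (b * (1 + t)) with (r - u r t) in Hpos; [lra|].
unfold b. field. lra.
Qed.

Lemma continuous_positive_lower_bound (f : R -> R) (T : R) :
  0 <= T -> continuous_on (fun t => 0 <= t) f -> (forall t, 0 <= t -> 0 < f t) ->
  exists m, 0 < m /\ forall t, 0 <= t <= T -> m <= f t.
Proof.
intros HT Hc Hp.
destruct (continuity_ab_min (fun t => f (Rmax 0 t)) 0 T HT) as [c [Hm Hi]].
- intros x Hx e He.
  destruct (continuous_on_eps _ _ (Rmax 0 x) Hc (Rmax_l 0 x) e He) as [d [Hd B]].
  exists d. split; [exact Hd|]. intros y [_ Hy]. simpl in *. unfold R_dist in *.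
  apply B; [apply Rmax_l|]. eapply Rle_lt_trans; [|exact Hy].
  unfold Rmax. repeat destruct (Rle_dec _ _); unfold Rabs; repeat destruct (Rcase_abs _); lra.
- exists (f (Rmax 0 c)). split; [apply Hp, Rmax_l|].
  intros t Ht. specialize (Hm t Ht). simpl in Hm. rewrite (Rmax_right 0 t) in Hm by lra. exact Hm.
Qed.

Lemma continuous_on_Rmin (D : R -> Prop) (f g : R -> R) :
  continuous_on D f -> (forall t, D t -> continuous g t) ->
  continuous_on D (fun t => Rmin (f t) (g t)).
Proof.
intros Hf Hg x Dx P [e HP].
destruct (continuous_on_eps D f x Hf Dx e (cond_pos e)) as [d [Hd B]].
assert (Hg' : continuous_on D g) by (apply continuous_on_forall; exact Hg).
destruct (continuous_on_eps D g x Hg' Dx e (cond_pos e)) as [d' [Hd' B']].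
assert (Hm : 0 < Rmin d d') by (apply Rmin_glb_lt; lra).
exists (mkposreal _ Hm). intros y Hy Dy. apply HP.
assert (m1 := Rmin_l d d'). assert (m2 := Rmin_r d d').
assert (Hy' : Rabs (y - x) < Rmin d d') by exact Hy.
specialize (B y Dy ltac:(lra)). specialize (B' y Dy ltac:(lra)).
change (Rabs (Rmin (f y) (g y) - Rmin (f x) (g x)) < e).
apply Rabs_def2 in B. apply Rabs_def2 in B'.
unfold Rmin. repeat destruct (Rle_dec _ _); apply Rabs_def1; lra.
Qed.

Section Lower.
Context {N : nat} {k0 P : R} {F p q : R -> R} (HF : extended_profile N k0 P F p q).
Variables (t0 : R).
Hypothesis Ht0 : 0 < t0.
Variables (k u0 du0 xi : R -> R) (u ur urr ut : R -> R -> R).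
Hypothesis sol : solution N k u0 xi u ur urr ut.
Hypothesis adm : admissible k (xi 0) u0 du0.
Hypothesis kmin : forall x, k0 <= k x.
Hypothesis init : forall r, 0 <= r <= xi 0 -> r <= radius P t0 ->
  dilate F (radius P t0) r <= u0 r.

(** The roles of the correction: [b r] prevents touching on the axis, [- b C r^2]
    pushes the boundary slope below [k0], and [- b M t] compensates what these two
    terms do to the equation. *)
Lemma lower_comparison t r b C M :
  0 <= t -> 0 < b -> 0 < C ->
  (forall s, 0 <= s <= t -> 1 < 2 * C * xi s) ->
  2 * P / radius P t0 * (1 + 2 * C * radius P (t + t0)) + 2 * C * INR N < M ->
  0 <= r <= Rmin (xi t) (radius P (t + t0)) ->
  0 < u r t - (dilate F (radius P (t + t0)) r + b * (r - C * r ^ 2) - b * (1 / (4 * C) + 1 + M * t)).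
Proof.
intros Ht Hb HC HCxi HM Hr.
assert (HN' := dim_minus_one_nonneg HF).
pose proof HF as [HN [Hk0 Hk1] HP cF _ DF Dp _ Ho _ F1 _].
set (Rd := fun s => radius P (s + t0)).
assert (RdP : forall s, 0 <= s -> 0 < Rd s) by (intros; apply radius_pos; lra).
assert (DRd : forall s, 0 <= s -> is_derive Rd s (P / Rd s)).
{ intros s Hs. replace (P / Rd s) with (P * 1 / Rd s) by (field; specialize (RdP s Hs); lra).
  apply (radius_derive P (fun s => s + t0)); [exact HP|lra|]. auto_derive; [trivial|ring]. }
assert (CRd : forall s, 0 <= s -> continuous Rd s).
{ intros s Hs. apply (ex_derive_continuous Rd). eexists. apply DRd, Hs. }
set (ze := fun s => Rmin (xi s) (Rd s)).
set (w := fun r s => dilate F (Rd s) r + b * (r - C * r ^ 2) - b * (1 / (4 * C) + 1 + M * s)).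
assert (Cz : continuous_on (fun s => 0 <= s) ze).
{ apply continuous_on_Rmin; [apply (sol_xi sol)|exact CRd]. }
(* The maximum of [x - C x^2], which the constant in the barrier compensates. *)
assert (Hsq : forall x, x - C * x ^ 2 <= 1 / (4 * C)).
{ intros x. assert (0 <= C * (x - 1 / (2 * C)) ^ 2) by (apply Rmult_le_pos; [lra|apply pow2_ge_0]).
  replace (C * (x - 1 / (2 * C)) ^ 2) with (C * x ^ 2 - x + 1 / (4 * C)) in H by (field; lra). lra. }
assert (HM0 : 0 < M).
{ assert (0 < 2 * P / radius P t0).
  { apply Rdiv_lt_0_compat; [lra|apply radius_pos; lra]. }
  assert (0 < radius P (t + t0)) by (apply radius_pos; lra).
  assert (0 < 2 * P / radius P t0 * (1 + 2 * C * radius P (t + t0))).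
  { apply Rmult_lt_0_compat; [lra|]. assert (0 < C * radius P (t + t0)) by (apply Rmult_lt_0_compat; lra). lra. }
  assert (0 <= 2 * C * INR N) by (apply Rmult_le_pos; lra). lra. }
assert (Hcorr : forall x s, 0 <= s -> b * (x - C * x ^ 2) - b * (1 / (4 * C) + 1 + M * s) < 0).
{ intros x s Hs. specialize (Hsq x). assert (0 <= M * s) by (apply Rmult_le_pos; lra). nra. }
apply (positive_unless_touch 0 t ze (fun r s => u r s - w r s)); try lra; try exact Cz.
- apply (continuous_on_minus_slab 0 ze xi); try lra.
  + intros; apply Rmin_l.
  + apply (sol_cont sol).
  + intros x s Hs. unfold w.
    apply (continuous_minus (V := R_NormedModule)); [apply (continuous_plus (V := R_NormedModule))|].
    * apply dilate_continuous; [exact cF|apply CRd, Hs|apply RdP, Hs].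
    * apply (continuous_comp fst (fun x => b * (x - C * x ^ 2))); [apply continuous_fst|].
      apply (ex_derive_continuous (fun x => b * (x - C * x ^ 2))). auto_derive. trivial.
    * apply (continuous_time (fun s => b * (1 / (4 * C) + 1 + M * s))).
      apply (ex_derive_continuous (fun s => b * (1 / (4 * C) + 1 + M * s))). auto_derive. trivial.
- intros x Hx. unfold ze in Hx. assert (m1 := Rmin_l (xi 0) (Rd 0)). assert (m2 := Rmin_r (xi 0) (Rd 0)).
  rewrite (sol_init sol) by (unfold segment; lra).
  specialize (Hcorr x 0 ltac:(lra)).
  assert (I := init x ltac:(lra)). unfold w, Rd in *. rewrite Rplus_0_l in *. specialize (I ltac:(lra)). lra.
- intros rs ts Hts Htouch. pose proof Htouch as [P1 [P2 [P3 [P4 P5]]]].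
  specialize (RdP ts ltac:(lra)).
  assert (Hxi := sol_pos sol ts ltac:(lra)).
  assert (m1 := Rmin_l (xi ts) (Rd ts)). assert (m2 := Rmin_r (xi ts) (Rd ts)).
  fold (ze ts) in m1, m2.
  assert (Hze : 0 < ze ts) by (unfold ze; apply Rmin_glb_lt; lra).
  destruct (Req_dec rs (Rd ts)) as [E|HrR].
  { assert (A := above_diagonal _ _ _ _ _ _ _ _ _ ts rs HN sol adm ltac:(lra) ltac:(lra)).
    specialize (Hcorr rs ts ltac:(lra)). unfold w, dilate in P3.
    rewrite <- E in P3. replace (rs / rs) with 1 in P3 by (field; lra). rewrite F1 in P3. lra. }
  destruct (Req_dec rs 0) as [E|Hr0].
  { subst rs. assert (Dr := sol_r sol ts 0 ltac:(lra) ltac:(unfold segment; lra)).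
    rewrite (sol_axis sol) in Dr by lra.
    assert (Dr' : is_deriv_on (segment 0 (ze ts)) (fun x => u x ts) 0 0).
    { intros Q HQ. destruct (Dr Q HQ) as [d Hd]. exists d. intros y Hy Hne Hy'. apply Hd; auto.
      unfold segment in *; lra. }
    destruct (flat_at_origin _ _ b (b * C) Dr' Hze Hb) as [x [Hx Bx]]; [nra|].
    specialize (P5 x ltac:(lra)). apply Rabs_def2 in Bx.
    assert (B := profile_near_origin HF (x / Rd ts)
       ltac:(apply ratio_inside_closed; lra)).
    unfold w, dilate in P3, P5. replace (0 / Rd ts) with 0 in P3 by (field; lra).
    assert (Rd ts * F 0 <= Rd ts * F (x / Rd ts)) by (apply Rmult_le_compat_l; lra).
    lra. }
  assert (Hin : 0 < rs < Rd ts) by lra.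
  assert (Hz := ratio_inside _ _ Hin).
  set (z := rs / Rd ts) in *.
  assert (Bp := profile_slope_bounds HF z ltac:(lra)).
  set (wr := fun r => p (r / Rd ts) + b * (1 - 2 * C * r)).
  assert (Dwr : forall r, 0 < r < Rd ts -> is_derive (fun x => w x ts) r (wr r)).
  { intros x Hx. destruct (dilate_derive_r F p q (Rd ts) x DF Dp Hx) as [Dx _].
    unfold w, wr. auto_derive; [exists (p (x / Rd ts)); exact Dx|].
    replace (Derive (fun y => dilate F (Rd ts) y) x) with (p (x / Rd ts))
      by (symmetry; apply is_derive_unique, Dx). ring. }
  destruct (Req_dec rs (xi ts)) as [E|Hrx].
  { assert (El : k (xi ts) - wr rs <= 0).
    { apply (deriv_on_left_nonpos (segment 0 (xi ts)) (fun x => u x ts - w x ts) rs _ rs); try lra.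
      - intros y Hy. unfold segment. lra.
      - rewrite <- (sol_slope sol) by lra.
        rewrite <- E at 2.
        apply deriv_on_minus; [|apply derive_deriv_on, Dwr, Hin].
        apply (sol_r sol ts rs); [lra|unfold segment; lra].
      - intros y Hy. specialize (P5 y ltac:(lra)). lra. }
    specialize (kmin (xi ts)). specialize (HCxi ts ltac:(lra)). unfold wr in El.
    fold z in El. rewrite E in El. nra. }
  assert (A : (q z / Rd ts - 2 * b * C) / (1 + wr rs ^ 2) + (INR N - 1) * wr rs / rs
     <= P / Rd ts * (F z - z * p z) - b * M).
  { assert (Hrs : 0 < rs < ze ts).
    { assert (ze ts = xi ts \/ ze ts = Rd ts).
      { unfold ze, Rmin. destruct (Rle_dec _ _); [left|right]; reflexivity. }
      lra. }
    apply (subsolution_touch N k u0 xi u ur urr ut w 0 ze wr rs ts (q z / Rd ts - 2 * b * C)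
       (P / Rd ts * (F z - z * p z) - b * M) sol Cz); try lra.
    - intros x Hx. apply Dwr. lra.
    - unfold wr. auto_derive; [exists (q z); exact (Dp z Hz)|].
      replace (Derive (fun x => p x) (rs * / Rd ts)) with (q z)
        by (symmetry; apply is_derive_unique, (Dp z Hz)). field. lra.
    - assert (Dt := dilate_derive_t F p Rd _ rs ts DF Hin (DRd ts ltac:(lra))).
      fold z in Dt. unfold w.
      apply (is_derive_minus (V := R_NormedModule)); [|auto_derive; [trivial|ring]].
      rewrite <- (Rplus_0_r (P / Rd ts * (F z - z * p z))).
      apply (is_derive_plus (V := R_NormedModule)); [exact Dt|].
      auto_derive; trivial.
    - exact Htouch. }
  specialize (Ho z Hz).
  assert (Bq := profile_convex HF z Hz).
  assert (Bq' := profile_curvature_bound HF z Hz).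
  set (rho := Rd ts) in *. set (y := p z) in *.
  assert (Hrz : rs = z * rho) by (unfold z; field; lra).
  set (B := 1 + 2 * C * radius P (t + t0)).
  assert (Hrho : rho <= radius P (t + t0)) by (apply radius_monotone; lra).
  assert (Hrho0 : radius P t0 <= rho) by (apply radius_monotone; lra).
  assert (HR0 : 0 < radius P t0) by (apply radius_pos; lra).
  assert (HB : Rabs (wr rs - y) <= b * B).
  { unfold wr. fold z y. replace (y + b * (1 - 2 * C * rs) - y) with (b * (1 - 2 * C * rs)) by ring.
    rewrite Rabs_mult, (Rabs_right b) by lra. apply Rmult_le_compat_l; [lra|].
    assert (0 < C * rs) by (apply Rmult_lt_0_compat; lra).
    assert (C * rs <= C * radius P (t + t0)) by (apply Rmult_le_compat_l; lra).
    unfold B. apply Rabs_le. lra. }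
  assert (HB0 : 0 <= b * B) by (eapply Rle_trans; [apply Rabs_pos|exact HB]).
  assert (I1 := inverse_one_plus_square (wr rs) y).
  assert (Hq0 : 0 <= q z / rho <= 2 * P / radius P t0).
  { split; [apply Rdiv_le_0_compat; lra|].
    apply Rle_trans with (2 * P / rho).
    - apply Rmult_le_compat_r; [left; apply Rinv_0_lt_compat; lra|lra].
    - apply Rmult_le_compat_l; [lra|]. apply Rinv_le_contravar; lra. }
  assert (I2 : q z / rho / (1 + y ^ 2) - 2 * P / radius P t0 * (b * B) - 2 * b * C
    <= (q z / rho - 2 * b * C) / (1 + wr rs ^ 2)).
  { assert (Hinv : 0 < / (1 + wr rs ^ 2) <= 1).
    { assert (1 <= 1 + wr rs ^ 2) by nra. split; [apply Rinv_0_lt_compat; lra|].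
      rewrite <- Rinv_1. apply Rinv_le_contravar; lra. }
    assert (Hbc : 0 < b * C) by (apply Rmult_lt_0_compat; lra).
    assert (I3 : q z / rho * (b * B) <= 2 * P / radius P t0 * (b * B)) by (apply Rmult_le_compat_r; lra).
    assert (I4 : - (b * B) <= / (1 + wr rs ^ 2) - / (1 + y ^ 2)).
    { apply Rabs_le_between in I1. lra. }
    assert (I5 : q z / rho * - (b * B) <= q z / rho * (/ (1 + wr rs ^ 2) - / (1 + y ^ 2)))
      by (apply Rmult_le_compat_l; lra).
    assert (I6 : 2 * b * C * / (1 + wr rs ^ 2) <= 2 * b * C * 1) by (apply Rmult_le_compat_l; lra).
    unfold Rdiv in *. lra. }
  assert (I7 : (INR N - 1) * wr rs / rs =
    (INR N - 1) / z * y / rho + (INR N - 1) * b / rs - 2 * b * C * (INR N - 1)).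
  { unfold wr. fold z y. rewrite Hrz. field. lra. }
  assert (I8 : 0 <= (INR N - 1) * b / rs).
  { apply Rdiv_le_0_compat; [apply Rmult_le_pos; lra|lra]. }
  assert (I9 : q z / rho / (1 + y ^ 2) + (INR N - 1) / z * y / rho = P / rho * (F z - z * y)).
  { assert (0 < 1 + y ^ 2) by nra.
    replace (q z / rho / (1 + y ^ 2)) with (q z / (1 + y ^ 2) / rho) by (field; lra).
    rewrite Ho. field. lra. }
  fold B in HM.
  assert (b * (2 * P / radius P t0 * B + 2 * C * INR N) < b * M) by (apply Rmult_lt_compat_l; lra).
  lra.
- exact Hr.
Qed.

(** Let [b] tend to 0 in the comparison. *)
Lemma lower_bound t r : 0 <= t -> 0 <= r <= xi t -> r <= radius P (t + t0) ->
  dilate F (radius P (t + t0)) r <= u r t.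
Proof.
intros Ht Hr HrR. assert (HP := profile_P HF).
destruct (continuous_positive_lower_bound xi t Ht (sol_xi sol)
  (sol_pos sol)) as [m [Hm Bm]].
(* With this [C] the slope [b (1 - 2 C r)] of the correction is negative on
   the free boundary. *)
set (C := / m). assert (HC : 0 < C) by (apply Rinv_0_lt_compat, Hm).
assert (HCxi : forall s, 0 <= s <= t -> 1 < 2 * C * xi s).
{ intros s Hs. specialize (Bm s Hs).
  assert (1 <= C * xi s); [|lra]. replace 1 with (C * m) by (unfold C; field; lra).
  apply Rmult_le_compat_l; lra. }
set (M := 2 * P / radius P t0 * (1 + 2 * C * radius P (t + t0)) + 2 * C * INR N + 1).
assert (Hmin : 0 <= r <= Rmin (xi t) (radius P (t + t0))) by (split; [lra|apply Rmin_glb; lra]).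
set (v := dilate F (radius P (t + t0)) r).
set (c := (r - C * r ^ 2) - (1 / (4 * C) + 1 + M * t)).
assert (Hb : forall b, 0 < b -> v + b * c < u r t).
{ intros b Hb. assert (L := lower_comparison t r b C M Ht Hb HC HCxi ltac:(unfold M; lra) Hmin).
  fold v in L. unfold c. lra. }
apply Rnot_lt_le. intro G.
assert (Hc : 0 < Rabs c + 1) by (generalize (Rabs_pos c); lra).
specialize (Hb ((v - u r t) / (Rabs c + 1)) ltac:(apply Rdiv_lt_0_compat; lra)).
assert (A : (v - u r t) / (Rabs c + 1) * - c <= v - u r t); [|lra].
apply Rle_trans with ((v - u r t) / (Rabs c + 1) * (Rabs c + 1)).
- apply Rmult_le_compat_l; [left; apply Rdiv_lt_0_compat; lra|].
  generalize (Rle_abs (- c)). rewrite Rabs_Ropp. lra.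
- right. field. lra.
Qed.
End Lower.

(** * Outer barrier and pinning *)

(** The dilated profile stretched vertically about the height [rho]: it still
    meets the diagonal at [rho], but with slope [(1 + delta) k0]. *)
Definition stretched (F : R -> R) (rho delta r : R) : R :=
  (1 + delta) * dilate F rho r - delta * rho.

Section Stretched.
Context {N : nat} {k0 P : R} {F p q : R -> R} (HF : extended_profile N k0 P F p q).

Lemma dilate_bounds rho r : 0 < rho -> 0 <= r <= rho ->
  rho - k0 * (rho - r) <= dilate F rho r <= rho /\
  dilate F rho r <= rho - k0 * (rho - r) + 2 * P * (rho - r) ^ 2 / rho.
Proof.
intros H0 Hr. assert (Hz := ratio_inside_closed r rho Hr H0).
assert (T := profile_above_tangent HF _ Hz). assert (Q := profile_below_parabola HF _ Hz).
unfold dilate.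
assert (E1 : rho * (1 - k0 * (1 - r / rho)) = rho - k0 * (rho - r)) by (field; lra).
assert (E2 : rho * (1 - k0 * (1 - r / rho) + 2 * P * (1 - r / rho) ^ 2) =
  rho - k0 * (rho - r) + 2 * P * (rho - r) ^ 2 / rho) by (field; lra).
split; [split|].
- rewrite <- E1. apply Rmult_le_compat_l; lra.
- rewrite <- (Rmult_1_r rho) at 3. apply Rmult_le_compat_l; lra.
- rewrite <- E2. apply Rmult_le_compat_l; lra.
Qed.

(** Dilation gains at least [(1 - k0) (rho2 - rho1)], which outweighs the loss of
    at most [delta2 k0 (rho2 - rho1)] from the stretching. *)
Lemma stretched_monotone rho1 rho2 delta1 delta2 r :
  0 < rho1 <= rho2 -> 0 <= delta2 <= delta1 -> delta2 * k0 <= 1 - k0 -> 0 <= r <= rho1 ->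
  stretched F rho1 delta1 r <= stretched F rho2 delta2 r.
Proof.
intros Hrho Hd Hdk Hr. unfold stretched.
assert (D := profile_dilation HF rho1 rho2 r Hr Hrho).
assert (B := proj1 (dilate_bounds rho1 r ltac:(lra) Hr)). unfold dilate in *.
set (A1 := rho1 * F (r / rho1)) in *. set (A2 := rho2 * F (r / rho2)) in *.
assert (0 <= (delta1 - delta2) * (rho1 - A1)) by (apply Rmult_le_pos; lra).
assert (delta2 * ((rho2 - rho1) - (A2 - A1)) <= delta2 * (k0 * (rho2 - rho1))).
{ apply Rmult_le_compat_l; lra. }
assert (delta2 * k0 * (rho2 - rho1) <= (1 - k0) * (rho2 - rho1)) by (apply Rmult_le_compat_r; lra).
lra.
Qed.

Lemma stretched_below_parabola rho delta r : 0 < rho -> 0 <= delta <= 1 -> 0 <= r <= rho ->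
  stretched F rho delta r <=
  rho - (1 + delta) * k0 * (rho - r) + 4 * P * (rho - r) ^ 2 / rho.
Proof.
intros H0 Hd Hr. assert (HP := profile_P HF).
assert (B := proj2 (dilate_bounds rho r H0 Hr)). unfold stretched.
assert (I : (1 + delta) * dilate F rho r <=
  (1 + delta) * (rho - k0 * (rho - r) + 2 * P * (rho - r) ^ 2 / rho)) by (apply Rmult_le_compat_l; lra).
assert (J : 0 <= 2 * P * (rho - r) ^ 2 / rho).
{ apply Rdiv_le_0_compat; [|lra]. apply Rmult_le_pos; [lra|apply pow2_ge_0]. }
replace (4 * P * (rho - r) ^ 2 / rho) with (2 * (2 * P * (rho - r) ^ 2 / rho)) by (field; lra).
assert (delta * (2 * P * (rho - r) ^ 2 / rho) <= 1 * (2 * P * (rho - r) ^ 2 / rho))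
  by (apply Rmult_le_compat_r; lra).
lra.
Qed.

Lemma stretched_above_diagonal rho delta r :
  0 < rho -> 0 <= delta -> (1 + delta) * k0 <= 1 -> 0 <= r <= rho ->
  r <= stretched F rho delta r.
Proof.
intros H0 Hd Hk Hr. assert (B := proj1 (proj1 (dilate_bounds rho r H0 Hr))). unfold stretched.
assert ((1 + delta) * (rho - k0 * (rho - r)) <= (1 + delta) * dilate F rho r) by (apply Rmult_le_compat_l; lra).
assert ((1 + delta) * k0 * (rho - r) <= 1 * (rho - r)) by (apply Rmult_le_compat_r; lra). lra.
Qed.

Lemma stretched_le_dilate rho delta r : 0 < rho -> 0 <= delta -> 0 <= r <= rho ->
  stretched F rho delta r <= dilate F rho r.
Proof.
intros H0 Hd Hr. assert (B := proj1 (dilate_bounds rho r H0 Hr)). unfold stretched.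
assert (0 <= delta * (rho - dilate F rho r)) by (apply Rmult_le_pos; lra). lra.
Qed.

(** This puts the initial datum below the barriers: a head start [rho - rho0] of
    the radius pays for the stretching. *)
Lemma dilate_le_stretched rho0 rho delta r :
  0 < rho0 <= rho -> 0 <= delta -> delta * k0 * rho <= (1 - k0) * (rho - rho0) ->
  0 <= r <= rho0 -> dilate F rho0 r <= stretched F rho delta r.
Proof.
intros H0 Hd Hk Hr. assert (D := profile_dilation HF rho0 rho r Hr H0).
assert (B := proj1 (dilate_bounds rho r ltac:(lra) ltac:(lra))). unfold stretched.
fold (dilate F rho r) (dilate F rho0 r) in D.
assert (Hk0 := profile_k0 HF).
assert (k0 * (rho - r) <= k0 * rho) by (apply Rmult_le_compat_l; lra).
assert (delta * (rho - dilate F rho r) <= delta * (k0 * rho)) by (apply Rmult_le_compat_l; lra).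
lra.
Qed.
End Stretched.

(** A fixed small fraction of the margin [theta] in the speed of the outer
    radius, so that the stretching costs less than the faster motion gains. *)
Definition slope_excess (k0 : R) (theta : R -> R) (t : R) : R :=
  (1 - k0) / 9 * theta t.

Section Upper.
Context {N : nat} {k0 P : R} {F p q : R -> R} (HF : extended_profile N k0 P F p q).
Context {k u0 du0 xi : R -> R} {u ur urr ut : R -> R -> R}.
Hypothesis sol : solution N k u0 xi u ur urr ut.
Hypothesis adm : admissible k (xi 0) u0 du0.
Variables (R0 : R) (rho theta theta' : R -> R).
Hypothesis R0_pos : 0 < R0.
Hypothesis init : forall r, 0 <= r <= xi 0 -> r <= R0 -> u0 r <= dilate F R0 r.
Hypothesis rho_pos : forall t, 0 <= t -> 0 < rho t.
Hypothesis rho_derive : forall t, 0 <= t -> is_derive rho t (P * (1 + theta t) / rho t).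
Hypothesis rho_monotone : forall s t, 0 <= s <= t -> rho s <= rho t.
Hypothesis theta_range : forall t, 0 <= t -> 0 < theta t <= 1.
Hypothesis theta_derive : forall t, 0 <= t -> is_derive theta t (theta' t).
Hypothesis theta'_nonpos : forall t, 0 <= t -> theta' t <= 0.
Hypothesis theta_monotone : forall s t, 0 <= s <= t -> theta t <= theta s.

Local Notation delta := (slope_excess k0 theta).

Lemma delta_range t : 0 <= t -> 0 < delta t <= (1 - k0) / 9.
Proof.
intros Ht. assert (Hk := profile_k0 HF). assert (T := theta_range t Ht). unfold slope_excess.
split; [apply Rmult_lt_0_compat; lra|]. nra.
Qed.

Lemma initial_radius : xi 0 <= R0.
Proof.
apply Rnot_lt_le. intro C.
assert (A := initial_above_diagonal _ _ _ _ R0 adm ltac:(lra)).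
assert (I := init R0 ltac:(lra) ltac:(lra)). unfold dilate in I.
replace (R0 / R0) with 1 in I by (field; lra). rewrite (profile_1 HF) in I. lra.
Qed.

(** The equation is satisfied with a margin of order [theta / rho]. The term
    [b (Cb - r)] uses up a part of it; its negative slope prevents touching on
    the axis, and its sign makes touching on the free boundary impossible while
    [xi <= rho]. *)
Lemma stretched_comparison T b Cb :
  0 <= T -> 0 < b -> (forall t, 0 <= t <= T -> rho t < Cb) ->
  (forall t, 0 <= t <= T -> 8 * b <= (1 - k0) * theta t) ->
  delta 0 * k0 * rho 0 <= (1 - k0) * (rho 0 - R0) -> 
  (forall t, 0 <= t <= T -> xi t <= rho t) ->
  forall r t, 0 <= t <= T -> 0 <= r <= xi t ->
  0 < stretched F (rho t) (delta t) r + b * (Cb - r) - u r t.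
Proof.
intros HT Hb HCb Hbt Hinit Hxr.
assert (HN' := dim_minus_one_nonneg HF).
pose proof HF as [HN [Hk0 Hk1] HP cF _ DF Dp _ Ho _ F1 _].
set (w := fun r t => stretched F (rho t) (delta t) r + b * (Cb - r)).
assert (Crho : forall s, 0 <= s -> continuous rho s).
{ intros s Hs. apply (ex_derive_continuous rho). eexists. apply rho_derive, Hs. }
assert (Ddelta : forall s, 0 <= s -> is_derive delta s ((1 - k0) / 9 * theta' s)).
{ intros s Hs. apply (is_derive_scal theta s ((1 - k0) / 9)), theta_derive, Hs. }
assert (Cdelta : forall s, 0 <= s -> continuous delta s).
{ intros s Hs. apply (ex_derive_continuous delta). eexists. apply Ddelta, Hs. }
assert (Cz := sol_xi sol).
assert (Hdk : forall s, 0 <= s -> 0 < delta s <= 1 /\ (1 + delta s) * k0 <= 1).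
{ intros s Hs. assert (D := delta_range s Hs). split; [lra|]. nra. }
apply (positive_unless_touch 0 T xi (fun r t => w r t - u r t)); try exact Cz.
- refine (proj1 (continuous_on_minus_slab 0 xi xi u w _ _ _ _)); try lra.
  + intros; lra.
  + apply (sol_cont sol).
  + intros x s Hs. unfold w, stretched.
    apply (continuous_plus (V := R_NormedModule)); [apply (continuous_minus (V := R_NormedModule))|].
    * apply (continuous_mult (K := R_AbsRing)).
      -- apply (continuous_plus (V := R_NormedModule)); [apply continuous_const|].
         apply continuous_time, Cdelta, Hs.
      -- apply dilate_continuous; [exact cF|apply Crho, Hs|apply rho_pos, Hs].
    * apply (continuous_mult (K := R_AbsRing));
        [apply continuous_time, Cdelta, Hs|apply continuous_time, Crho, Hs].
    * apply (continuous_comp fst (fun x => b * (Cb - x))); [apply continuous_fst|].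
      apply (ex_derive_continuous (fun x => b * (Cb - x))). auto_derive. trivial.
- intros x Hx. rewrite (sol_init sol) by (unfold segment; lra).
  assert (R1 := initial_radius). assert (I := init x Hx ltac:(lra)).
  assert (HR := rho_pos 0 ltac:(lra)). destruct (Hdk 0 ltac:(lra)) as [D0 _].
  assert (HRR : R0 <= rho 0).
  { assert (0 < delta 0 * k0 * rho 0)
      by (apply Rmult_lt_0_compat; [apply Rmult_lt_0_compat|]; lra).
    apply Rmult_le_reg_l with (1 - k0); lra. }
  assert (I2 := dilate_le_stretched HF R0 (rho 0) (delta 0) x ltac:(lra) ltac:(lra) Hinit ltac:(lra)).
  specialize (HCb 0 ltac:(lra)).
  assert (0 < b * (Cb - x)) by (apply Rmult_lt_0_compat; lra). unfold w. lra.
- intros rs ts Hts Htouch. pose proof Htouch as [P1 [P2 [P3 [P4 P5]]]].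
  assert (HR := rho_pos ts ltac:(lra)).
  assert (Hxi := sol_pos sol ts ltac:(lra)).
  specialize (Hxr ts ltac:(lra)). specialize (HCb ts ltac:(lra)).
  destruct (Hdk ts ltac:(lra)) as [D0 D1].
  unfold w in P3, P5.
  destruct (Req_dec rs (xi ts)) as [E|Hrx].
  { rewrite E, (sol_bdry sol) in P3 by lra.
    assert (S := stretched_above_diagonal HF (rho ts) (delta ts) (xi ts) HR ltac:(lra) D1 ltac:(lra)).
    assert (0 < b * (Cb - xi ts)) by (apply Rmult_lt_0_compat; lra). lra. }
  destruct (Req_dec rs 0) as [E|Hr0].
  { subst rs. assert (Dr := sol_r sol ts 0 ltac:(lra) ltac:(unfold segment; lra)).
    rewrite (sol_axis sol) in Dr by lra.
    destruct (flat_at_origin _ _ b (4 * P / rho ts) Dr Hxi Hb) as [x [Hx Bx]].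
    { apply Rdiv_le_0_compat; lra. }
    specialize (P5 x ltac:(lra)). apply Rabs_def2 in Bx.
    assert (B := profile_near_origin HF (x / rho ts) ltac:(apply ratio_inside_closed; lra)).
    unfold stretched, dilate in P3, P5. replace (0 / rho ts) with 0 in P3 by (field; lra).
    assert (B1 : rho ts * F (x / rho ts) <= rho ts * F 0 + 2 * P / rho ts * x ^ 2).
    { replace (rho ts * F 0 + 2 * P / rho ts * x ^ 2) with
        (rho ts * (F 0 + 2 * P * (x / rho ts) ^ 2)) by (field; lra).
      apply Rmult_le_compat_l; lra. }
    assert (B2 : 0 <= 2 * P / rho ts * x ^ 2).
    { apply Rmult_le_pos; [apply Rdiv_le_0_compat; lra|apply pow2_ge_0]. }
    replace (4 * P / rho ts * x ^ 2) with (2 * (2 * P / rho ts * x ^ 2)) in Bx by (field; lra).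
    set (G := 2 * P / rho ts * x ^ 2) in *.
    assert ((1 + delta ts) * (rho ts * F (x / rho ts)) <= (1 + delta ts) * (rho ts * F 0 + G))
      by (apply Rmult_le_compat_l; lra).
    assert (delta ts * G <= 1 * G) by (apply Rmult_le_compat_r; lra).
    lra. }
  assert (Hin : 0 < rs < rho ts) by lra.
  assert (Hz := ratio_inside _ _ Hin).
  set (R1 := rho ts) in *. set (z := rs / R1) in *. set (d := delta ts) in *.
  set (rho' := P * (1 + theta ts) / R1).
  set (wr := fun r => (1 + d) * p (r / R1) - b).
  assert (A : (1 + d) * (rho' * (F z - z * p z)) + (1 - k0) / 9 * theta' ts * (R1 * F z - R1) - d * rho'
     <= ((1 + d) * q z / R1) / (1 + wr rs ^ 2) + (INR N - 1) * wr rs / rs).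
  { apply (supersolution_touch N k u0 xi u ur urr ut w 0 xi wr rs ts ((1 + d) * q z / R1)
      ((1 + d) * (rho' * (F z - z * p z)) + (1 - k0) / 9 * theta' ts * (R1 * F z - R1) - d * rho') sol Cz); try lra.
    - intros x Hx. destruct (dilate_derive_r F p q R1 x DF Dp ltac:(lra)) as [Dx _].
      unfold w, wr, stretched. fold R1 d. auto_derive; [exists (p (x / R1)); exact Dx|].
      replace (Derive (fun y => dilate F R1 y) x) with (p (x / R1))
        by (symmetry; apply is_derive_unique, Dx). ring.
    - unfold wr. auto_derive; [exists (q z); exact (Dp z Hz)|].
      replace (Derive (fun x => p x) (rs * / R1)) with (q z)
        by (symmetry; apply is_derive_unique, (Dp z Hz)). field. lra.
    - assert (Dt := dilate_derive_t F p rho _ rs ts DF Hin (rho_derive ts ltac:(lra))).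
      fold R1 in Dt. fold z rho' in Dt.
      assert (Dd := Ddelta ts ltac:(lra)). assert (DR := rho_derive ts ltac:(lra)).
      fold R1 rho' in DR.
      assert (Dall : is_derive (fun t => (1 + delta t) * dilate F (rho t) rs - delta t * rho t) ts
        (((0 + (1 - k0) / 9 * theta' ts) * dilate F (rho ts) rs + (1 + delta ts) * (rho' * (F z - z * p z)))
          - ((1 - k0) / 9 * theta' ts * rho ts + delta ts * rho'))).
      { apply (is_derive_minus (V := R_NormedModule)).
        - apply (is_derive_mult (fun t => 1 + delta t) (fun t => dilate F (rho t) rs) ts); [|exact Dt|exact Rmult_comm].
          apply (is_derive_plus (V := R_NormedModule)); [auto_derive; trivial|exact Dd].
        - apply (is_derive_mult delta rho ts); [exact Dd|exact DR|exact Rmult_comm]. }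
      unfold w, stretched.
      replace ((1 + d) * (rho' * (F z - z * p z)) + (1 - k0) / 9 * theta' ts * (R1 * F z - R1) - d * rho')
        with ((((0 + (1 - k0) / 9 * theta' ts) * dilate F (rho ts) rs + (1 + delta ts) * (rho' * (F z - z * p z)))
          - ((1 - k0) / 9 * theta' ts * rho ts + delta ts * rho')) + 0)
        by (unfold dilate; fold R1 z d; ring).
      apply (is_derive_plus (V := R_NormedModule)); [exact Dall|auto_derive; trivial].
    - exact Htouch. }
  specialize (Ho z Hz). specialize (Hbt ts ltac:(lra)).
  assert (Bq := profile_convex HF z Hz).
  assert (Bq' := profile_curvature_bound HF z Hz).
  assert (Bp := profile_slope_bounds HF z ltac:(lra)).
  assert (BH := profile_legendre HF z ltac:(lra)).
  assert (BF := profile_above_tangent HF z ltac:(lra)).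
  assert (Hrz : rs = z * R1) by (unfold z; field; lra).
  set (y := p z) in *. set (H := F z - z * y) in *.
  assert (Hth := theta_range ts ltac:(lra)). assert (Hth' := theta'_nonpos ts ltac:(lra)).
  assert (J1 : 0 <= (1 - k0) / 9 * theta' ts * (R1 * F z - R1)).
  { replace ((1 - k0) / 9 * theta' ts * (R1 * F z - R1)) with
      ((1 - k0) / 9 * (- theta' ts) * (R1 * (1 - F z))) by ring.
    repeat apply Rmult_le_pos; lra. }
  assert (J2 : / (1 + wr rs ^ 2) <= / (1 + y ^ 2) + b).
  { assert (I1 := inverse_one_plus_square (wr rs) ((1 + d) * y)).
    replace (wr rs - (1 + d) * y) with (- b) in I1 by (unfold wr; fold z y; ring).
    rewrite Rabs_Ropp, (Rabs_right b) in I1 by lra. apply Rabs_le_between in I1.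
    assert (/ (1 + ((1 + d) * y) ^ 2) <= / (1 + y ^ 2)); [|lra].
    apply Rinv_le_contravar; [nra|].
    assert (y ^ 2 <= ((1 + d) * y) ^ 2); [|lra]. apply pow_incr. nra. }
  assert (J3 : (1 + d) * q z / R1 / (1 + wr rs ^ 2) <=
    (1 + d) / R1 * (q z / (1 + y ^ 2)) + 4 * P * b / R1).
  { assert (Hq : 0 <= (1 + d) * q z / R1 <= 4 * P / R1).
    { split; [apply Rdiv_le_0_compat; [apply Rmult_le_pos; lra|lra]|].
      apply Rmult_le_compat_r; [left; apply Rinv_0_lt_compat; lra|]. nra. }
    assert (K1 : (1 + d) * q z / R1 * / (1 + wr rs ^ 2) <= (1 + d) * q z / R1 * (/ (1 + y ^ 2) + b))
      by (apply Rmult_le_compat_l; lra).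
    assert (K2 : (1 + d) * q z / R1 * b <= 4 * P / R1 * b) by (apply Rmult_le_compat_r; lra).
    unfold Rdiv in *. lra. }
  assert (J4 : (INR N - 1) * wr rs / rs <= (1 + d) / R1 * ((INR N - 1) / z * y)).
  { replace ((INR N - 1) * wr rs / rs) with
      ((1 + d) / R1 * ((INR N - 1) / z * y) - (INR N - 1) * b / rs).
    - assert (0 <= (INR N - 1) * b / rs); [|lra].
      apply Rdiv_le_0_compat; [apply Rmult_le_pos; lra|lra].
    - unfold wr. fold z y. rewrite Hrz. field. lra. }
  assert (J5 : (1 + d) / R1 * (q z / (1 + y ^ 2)) + (1 + d) / R1 * ((INR N - 1) / z * y) =
     (1 + d) * P * H / R1).
  { rewrite Ho. field. lra. }
  assert (J6 : (1 + d) * (rho' * H) - d * rho' <= (1 + d) * P * H / R1 + 4 * P * b / R1) by lra.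
  assert (J7 : P / R1 * ((1 + d) * (1 + theta ts) * H - d * (1 + theta ts)) <=
     P / R1 * ((1 + d) * H + 4 * b)).
  { unfold rho' in J6.
    replace (P / R1 * ((1 + d) * (1 + theta ts) * H - d * (1 + theta ts))) with
      ((1 + d) * (P * (1 + theta ts) / R1 * H) - d * (P * (1 + theta ts) / R1)) by (field; lra).
    replace (P / R1 * ((1 + d) * H + 4 * b)) with
      ((1 + d) * P * H / R1 + 4 * P * b / R1) by (field; lra). exact J6. }
  apply Rmult_le_reg_l in J7; [|apply Rdiv_lt_0_compat; lra].
  assert (J8 : (1 - k0) * theta ts <= (1 + d) * H * theta ts).
  { apply Rmult_le_compat_r; [lra|]. nra. }
  assert (J9 : d * theta ts <= d * 1) by (apply Rmult_le_compat_l; lra).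
  assert (Ed : d = (1 - k0) / 9 * theta ts) by reflexivity.
  assert (0 < (1 - k0) * theta ts) by (apply Rmult_lt_0_compat; lra).
  lra.
Qed.

Variable eps : R.
Hypothesis eps_pos : 0 < eps.
Hypothesis k_periodic : periodic eps k.
Hypothesis k_minimum : is_minimum k k0.

(** Periodicity brings the minimum point of [k] into any half-open interval of
    length [eps]. *)
Lemma pinning_radius x : exists X, k X = k0 /\ x - eps <= X < x.
Proof.
destruct k_minimum as [[x0 E0] _].
assert (Hn : forall n y, k (y + INR n * eps) = k y).
{ induction n as [|n IH]; intros y; [simpl; f_equal; ring|].
  rewrite S_INR, <- (IH y). rewrite <- (k_periodic (y + INR n * eps)). f_equal. ring. }
assert (Hz : forall n : Z, k (x0 + IZR n * eps) = k0).
{ intros n. destruct (Z_le_gt_dec 0 n) as [Hp|Hneg].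
  - rewrite <- E0, <- (Z2Nat.id n Hp), <- INR_IZR_INZ. apply Hn.
  - rewrite <- E0, <- (Hn (Z.to_nat (- n)) (x0 + IZR n * eps)). f_equal.
    rewrite INR_IZR_INZ, Z2Nat.id by lia. rewrite opp_IZR. ring. }
destruct (archimed ((x - x0) / eps)) as [A1 A2].
set (m := up ((x - x0) / eps)) in *.
assert (Ex : x = x0 + (x - x0) / eps * eps) by (field; lra).
set (y := (x - x0) / eps) in *.
destruct (Req_dec (IZR m - y) 1) as [E|Hne].
- exists (x0 + IZR (m - 2) * eps). split; [apply Hz|]. rewrite minus_IZR.
  rewrite Ex. replace (IZR m) with (y + 1) by lra. split; nra.
- exists (x0 + IZR (m - 1) * eps). split; [apply Hz|]. rewrite minus_IZR.
  rewrite Ex. split; nra.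
Qed.

(** If [xi] reached [rho] at the time [ts], it would have crossed the last pinning
    radius [X] below [rho ts]. The static parabola [A] through [(X, X)] prevents
    this. It can be used from time 0 on, because the outer barrier increases in
    time: what holds at the inner edge of the layer at [ts] holds before. *)
Lemma pinned_boundary ts :
  0 < ts -> (forall t, 0 <= t <= ts -> xi t <= rho t) ->
  (forall r t, 0 <= t <= ts -> 0 <= r <= xi t ->
     u r t < stretched F (rho t) (delta t) r + eps) ->
  delta ts * k0 * rho ts <= (1 - k0) * (rho ts - eps - R0) ->
  32 * (2 * INR N + 16 * P) * eps < (delta ts * k0) ^ 2 * (rho ts - eps) ->
  xi ts < rho ts.
Proof.
intros Hts Hxr Hu Hinit Hpin.
assert (HN' := dim_minus_one_nonneg HF).
pose proof HF as [_ [Hk0 Hk1] HP _ _ _ _ _ _ _ _ _].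
assert (Cz := sol_xi sol).
destruct (pinning_radius (rho ts)) as [X [kX HX]].
assert (HR := rho_pos ts ltac:(lra)).
assert (Hd := delta_range ts ltac:(lra)).
set (d := delta ts) in *. set (rs := rho ts) in *.
assert (Hdk : 0 < d * k0 <= (1 - k0) / 9) by (split; nra).
assert (HRX : R0 < X /\ d * k0 * X <= (1 - k0) * (X - R0)).
{ assert (0 < d * k0 * rs) by (apply Rmult_lt_0_compat; lra).
  assert (d * k0 * X <= d * k0 * rs) by (apply Rmult_le_compat_l; lra).
  assert ((1 - k0) * (rs - eps - R0) <= (1 - k0) * (X - R0)) by (apply Rmult_le_compat_l; lra).
  split; [|lra]. assert (0 < X - R0); [|lra]. apply Rmult_lt_reg_l with (1 - k0); lra. }
destruct HRX as [HRX HdX].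
(* Over the layer the parabola loses [2 N L^2 / X] by its own curvature, and the
   outer barrier gains at most [16 P L^2 / X] by its curvature. *)
set (K := 2 * INR N + 16 * P) in *.
assert (HK : 2 < K) by (unfold K; lra).
set (mu := d * k0 / 2).
(* The maximum point of [mu x - K x^2 / X]. *)
set (L := mu * X / (2 * K)).
assert (HL : 0 < L) by (unfold L; apply Rdiv_lt_0_compat; [apply Rmult_lt_0_compat; unfold mu; lra|lra]).
assert (Hmu : 0 < mu <= (1 - k0) / 18) by (unfold mu; lra).
assert (EL : K * L = mu * X / 2) by (unfold L; field; lra).
assert (Hpin' : 32 * K * eps < (2 * mu) ^ 2 * X).
{ apply Rlt_le_trans with (1 := Hpin). replace (2 * mu) with (d * k0) by (unfold mu; field).
  apply Rmult_le_compat_l; [apply pow2_ge_0|lra]. }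
assert (HLX : L <= X / 2) by nra.
(* The outer boundary is within [eps] of [X], hence within [2 L] of the inner
   edge of the layer. *)
assert (HeL : eps <= L).
{ apply Rmult_le_reg_l with (32 * K); [lra|].
  replace (32 * K * L) with (16 * mu * X) by lra.
  assert ((2 * mu) ^ 2 * X <= 16 * mu * X); [|lra].
  apply Rmult_le_compat_r; [lra|]. nra. }
set (a := X - L).
(* The second derivative [- 4 N / X] outweighs the term [(N - 1) u_r / r]
   because [r >= X / 2] and [u_r <= 1] in the layer. *)
set (A := fun r => X - (k0 + mu) * (X - r) - 2 * INR N * (X - r) ^ 2 / X).
set (A' := fun r => k0 + mu + 4 * INR N * (X - r) / X).
assert (DA : forall r, is_derive A r (A' r)).
{ intros r. unfold A, A'. auto_derive; [lra|field; lra]. }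
assert (DA' : forall r, is_derive A' r (- 4 * INR N / X)).
{ intros r. unfold A'. auto_derive; [lra|field; lra]. }
assert (HA' : forall r, a <= r <= X -> 0 < A' r <= 1).
{ intros r Hr. unfold A'.
  assert (0 <= 4 * INR N * (X - r) / X) by (apply Rdiv_le_0_compat; [apply Rmult_le_pos; lra|lra]).
  assert (4 * INR N * (X - r) / X <= mu); [|lra].
  apply Rmult_le_reg_r with X; [lra|].
  replace (4 * INR N * (X - r) / X * X) with (4 * INR N * (X - r)) by (field; lra).
  apply Rle_trans with (2 * K * L).
  - apply Rmult_le_compat; try lra; unfold K, a in *; lra.
  - rewrite Rmult_assoc, EL. lra. }
assert (HAbelow : forall r, X <= r -> A r <= r).
{ intros r Hr. unfold A.
  assert (0 <= 2 * INR N * (X - r) ^ 2 / X).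
  { apply Rdiv_le_0_compat; [apply Rmult_le_pos; [lra|apply pow2_ge_0]|lra]. }
  nra. }
assert (HAabove : forall r, a <= r < X -> r < A r).
{ intros r Hr. assert (B := HA' r ltac:(lra)). unfold A' in B. unfold A.
  replace (2 * INR N * (X - r) ^ 2 / X) with (4 * INR N * (X - r) / X * (X - r) / 2) by (field; lra).
  assert (4 * INR N * (X - r) / X * (X - r) <= (1 - k0 - mu) * (X - r)) by (apply Rmult_le_compat_r; lra).
  assert (0 < (1 - k0 - mu) * (X - r)) by (apply Rmult_lt_0_compat; lra). lra. }
assert (HX0 := initial_radius).
assert (Hpos : forall r t, 0 <= t <= ts -> a <= r <= xi t -> 0 < A r - u r t).
{ apply (positive_unless_touch a ts xi (fun r t => A r - u r t)); try exact Cz.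
  - refine (proj1 (continuous_on_minus_slab a xi xi u (fun r _ => A r) _ _ _ _)).
    + unfold a; lra.
    + intros; lra.
    + apply (sol_cont sol).
    + intros r t _. apply (continuous_comp fst A); [apply continuous_fst|].
      apply (ex_derive_continuous A). eexists. apply DA.
  - intros r Hr. rewrite (sol_init sol) by (unfold segment, a in *; lra).
    assert (I := init r ltac:(unfold a in *; lra) ltac:(lra)).
    assert (I2 := dilate_le_stretched HF R0 X d r ltac:(lra) ltac:(lra) HdX ltac:(unfold a in *; lra)).
    assert (I3 := stretched_below_parabola HF X d r ltac:(lra) ltac:(lra) ltac:(unfold a in *; lra)).
    apply Rle_lt_trans with (X - (1 + d) * k0 * (X - r) + 4 * P * (X - r) ^ 2 / X - u0 r); [lra|].
    apply Rplus_lt_compat_r. unfold A.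
    assert (HXr : 0 < X - r <= L) by (unfold a in *; lra).
    assert (J : (2 * INR N + 4 * P) * (X - r) / X <= mu / 2).
    { apply Rmult_le_reg_r with X; [lra|].
      replace ((2 * INR N + 4 * P) * (X - r) / X * X) with ((2 * INR N + 4 * P) * (X - r)) by (field; lra).
      replace (mu / 2 * X) with (K * L) by lra.
      apply Rmult_le_compat; unfold K; lra. }
    replace (4 * P * (X - r) ^ 2 / X) with
      ((2 * INR N + 4 * P) * (X - r) / X * (X - r) - 2 * INR N * (X - r) ^ 2 / X) by (field; lra).
    assert ((2 * INR N + 4 * P) * (X - r) / X * (X - r) <= mu / 2 * (X - r)) by (apply Rmult_le_compat_r; lra).
    assert (0 < mu * (X - r)) by (apply Rmult_lt_0_compat; lra).
    unfold mu in *. lra.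
  - intros r t Ht Htouch. pose proof Htouch as [P1 [P2 [P3 [P4 P5]]]]. simpl in P3, P4, P5.
    specialize (Hxr t ltac:(lra)).
    assert (Hrt : 0 < rho t <= rs) by (split; [apply rho_pos|apply rho_monotone]; lra).
    destruct (Req_dec r a) as [E|Hra].
    { subst r. specialize (Hu a t ltac:(lra) ltac:(unfold a in *; lra)).
      assert (Hdt : d <= delta t).
      { unfold d, slope_excess. apply Rmult_le_compat_l; [lra|]. apply theta_monotone. lra. }
      assert (S := stretched_monotone HF (rho t) rs (delta t) d a Hrt ltac:(lra) ltac:(lra)
         ltac:(unfold a in *; lra)).
      assert (Q := stretched_below_parabola HF rs d a ltac:(lra) ltac:(lra) ltac:(unfold a; lra)).
      assert (Hy : 0 <= rs - a <= 2 * L) by (unfold a; lra).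
      assert (Q1 : 4 * P * (rs - a) ^ 2 / rs <= 16 * P * L ^ 2 / X).
      { apply Rle_trans with (16 * P * L ^ 2 / rs).
        - apply Rmult_le_compat_r; [left; apply Rinv_0_lt_compat; lra|].
          replace (16 * P * L ^ 2) with (4 * P * (2 * L) ^ 2) by ring.
          apply Rmult_le_compat_l; [lra|]. apply pow_incr. lra.
        - apply Rmult_le_compat_l; [apply Rmult_le_pos; [lra|apply pow2_ge_0]|].
          apply Rinv_le_contravar; lra. }
      assert (Q2 : (1 + d) * k0 * L <= (1 + d) * k0 * (rs - a)).
      { apply Rmult_le_compat_l; [apply Rmult_le_pos; lra|unfold a; lra]. }
      assert (EA : A a = X - (k0 + mu) * L - 2 * INR N * L ^ 2 / X).
      { unfold A, a. replace (X - (X - L)) with L by ring. reflexivity. }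
      assert (Q3 : 2 * INR N * L ^ 2 / X + 16 * P * L ^ 2 / X = mu * L / 2).
      { replace (2 * INR N * L ^ 2 / X + 16 * P * L ^ 2 / X) with (K * L * L / X) by (unfold K; field; lra).
        rewrite EL. field. lra. }
      assert (Q4 : 2 * eps < mu * L / 2).
      { apply Rmult_lt_reg_l with (16 * K); [lra|].
        replace (16 * K * (mu * L / 2)) with (8 * mu * (K * L)) by field. rewrite EL.
        lra. }
      assert (d * k0 * L = 2 * mu * L) by (unfold mu; field).
      unfold a in *. lra. }
    (* At earlier times [u < A] on the free boundary, so it lies to the left of [X]. *)
    assert (HxX : xi t <= X).
    { apply Rnot_lt_le. intro C.
      destruct (continuous_on_eps _ _ t Cz ltac:(lra) (xi t - X) ltac:(lra)) as [e [He Be]].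
      assert (e1 := Rmin_l t e). assert (e2 := Rmin_r t e).
      assert (e0 : 0 < Rmin t e) by (apply Rmin_glb_lt; lra).
      set (s := t - Rmin t e / 2).
      assert (Hs : 0 < s < t) by (unfold s; lra).
      specialize (Be s ltac:(lra)).
      rewrite Rabs_left in Be by lra. specialize (Be ltac:(unfold s; lra)). apply Rabs_def2 in Be.
      specialize (P4 (xi s) s ltac:(lra) ltac:(unfold a; lra)).
      rewrite (sol_bdry sol) in P4 by lra. specialize (HAbelow (xi s) ltac:(lra)). lra. }
    destruct (Req_dec r (xi t)) as [E|Hrx].
    { rewrite E, (sol_bdry sol) in P3 by lra.
      assert (EX : xi t = X).
      { apply Rle_antisym; [exact HxX|]. apply Rnot_lt_le. intro C.
        specialize (HAabove (xi t) ltac:(lra)). lra. }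
      assert (El : A' X - k0 <= 0).
      { apply (deriv_on_left_nonpos (segment 0 (xi t)) (fun x => A x - u x t) X _ L HL).
        - intros y Hy. unfold segment, a in *. lra.
        - apply deriv_on_minus; [apply derive_deriv_on, DA|].
          rewrite <- kX. rewrite <- EX, <- (sol_slope sol) by lra.
          apply (sol_r sol); [lra|unfold segment, a in *; lra].
        - intros y Hy. specialize (P5 y ltac:(unfold a; lra)).
          assert (A X - u X t <= 0); [|lra].
          rewrite <- EX at 2. rewrite (sol_bdry sol), EX by lra. specialize (HAbelow X ltac:(lra)). lra. }
      unfold A' in El. replace (X - X) with 0 in El by ring.
      replace (4 * INR N * 0 / X) with 0 in El by (field; lra). lra. }
    assert (Hr : a < r < xi t) by lra.
    assert (Sup := supersolution_touch N k u0 xi u ur urr ut (fun r _ => A r) a xi A' r t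
      (- 4 * INR N / X) 0 sol Cz ltac:(unfold a; lra) ltac:(lra) Hr (fun r _ => DA r) (DA' r)
      ltac:(auto_derive; trivial) Htouch).
    assert (B := HA' r ltac:(lra)).
    assert (S1 : - 4 * INR N / X / (1 + A' r ^ 2) <= - 2 * INR N / X).
    { replace (- 2 * INR N / X) with (- 4 * INR N / X * / 2) by (field; lra).
      replace (- 4 * INR N / X) with (- (4 * INR N / X)) by (field; lra).
      assert (/ 2 <= / (1 + A' r ^ 2)) by (apply Rinv_le_contravar; nra).
      assert (0 <= 4 * INR N / X) by (apply Rdiv_le_0_compat; lra).
      assert (4 * INR N / X * / 2 <= 4 * INR N / X * / (1 + A' r ^ 2)) by (apply Rmult_le_compat_l; lra).
      unfold Rdiv in *. lra. }
    assert (S2 : (INR N - 1) * A' r / r <= 2 * (INR N - 1) / X).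
    { replace (2 * (INR N - 1) / X) with ((INR N - 1) * 1 * / (X / 2)) by (field; lra).
      apply Rmult_le_compat; [apply Rmult_le_pos; lra| |apply Rmult_le_compat_l; lra|].
      - left. apply Rinv_0_lt_compat. unfold a in *. lra.
      - apply Rinv_le_contravar; unfold a in *; lra. }
    assert (S3 : - 2 * INR N / X + 2 * (INR N - 1) / X = - (2 / X)) by (field; lra).
    assert (0 < 2 / X) by (apply Rdiv_lt_0_compat; lra). lra. }
apply Rnot_le_lt. intro C.
specialize (Hpos (xi ts) ts ltac:(lra) ltac:(unfold a; lra)).
rewrite (sol_bdry sol) in Hpos by lra.
specialize (HAbelow (xi ts) ltac:(lra)). lra.
Qed.

(** The comparison with the outer barrier needs [xi <= rho], and the pinning
    argument needs that comparison. The first time at which [xi = rho] breaks the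
    circle: both apply up to and including that time. *)
Lemma tracking T :
  0 <= T ->
  (forall t, 0 <= t <= T -> delta t * k0 * rho t <= (1 - k0) * (rho t - eps - R0)) ->
  (forall t, 0 <= t <= T ->
     32 * (2 * INR N + 16 * P) * eps < (delta t * k0) ^ 2 * (rho t - eps)) ->
  forall r t, 0 <= t <= T -> 0 <= r <= xi t ->
  r <= rho t /\ u r t < stretched F (rho t) (delta t) r + eps.
Proof.
intros HT Hinit Hpin.
pose proof HF as [_ [Hk0 Hk1] _ _ _ _ _ _ _ _ _ _].
assert (HR := rho_pos T HT). assert (Hth := theta_range T HT).
assert (Hcomp : forall T', 0 <= T' <= T -> (forall t, 0 <= t <= T' -> xi t <= rho t) ->
  forall r t, 0 <= t <= T' -> 0 <= r <= xi t ->
  u r t < stretched F (rho t) (delta t) r + eps).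
{ intros T' HT' Hxr r t Ht Hr.
  (* The first entry keeps the correction below [eps], the second one keeps it
     within the margin of the outer barrier. *)
  set (b := Rmin (eps / (rho T + 2)) ((1 - k0) * theta T / 8)).
  assert (b1 := Rmin_l (eps / (rho T + 2)) ((1 - k0) * theta T / 8)).
  assert (b2 := Rmin_r (eps / (rho T + 2)) ((1 - k0) * theta T / 8)).
  fold b in b1, b2.
  assert (Hb : 0 < b).
  { apply Rmin_glb_lt; [apply Rdiv_lt_0_compat; lra|].
    assert (0 < (1 - k0) * theta T) by (apply Rmult_lt_0_compat; lra). lra. }
  assert (B := stretched_comparison T' b (rho T + 1) ltac:(lra) Hb).
  assert (B' : 0 < stretched F (rho t) (delta t) r + b * (rho T + 1 - r) - u r t).
  { apply B; try assumption.
    - intros s Hs. assert (rho s <= rho T) by (apply rho_monotone; lra). lra.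
    - intros s Hs. assert ((1 - k0) * theta T <= (1 - k0) * theta s); [|lra].
      apply Rmult_le_compat_l; [lra|]. apply theta_monotone. lra.
    - specialize (Hinit 0 ltac:(lra)).
      assert (0 < (1 - k0) * eps) by (apply Rmult_lt_0_compat; lra). lra. }
  assert (b * (rho T + 1 - r) <= eps); [|lra].
  apply Rle_trans with (eps / (rho T + 2) * (rho T + 2)).
  - apply Rle_trans with (b * (rho T + 2)).
    + apply Rmult_le_compat_l; lra.
    + apply Rmult_le_compat_r; lra.
  - right. field. lra. }
assert (Hxi : forall r t, 0 <= t <= T -> 0 <= r <= xi t -> 0 < rho t - xi t).
{ assert (Cz := sol_xi sol).
  apply (positive_unless_touch 0 T xi (fun _ t => rho t - xi t) Cz).
  - refine (proj1 (continuous_on_minus_slab 0 xi xi (fun _ t => xi t) (fun _ t => rho t) _ _ _ _)).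
    + lra.
    + intros; lra.
    + intros [r t] [_ Ht]. simpl in Ht. intros Q [e HQ].
      destruct (continuous_on_eps _ _ t Cz Ht e (cond_pos e)) as [d [Hd Bd]].
      exists (mkposreal d Hd). intros [r' t'] [_ Hy] [_ Hy']. apply HQ. apply Bd; assumption.
    + intros r t Ht. apply continuous_time, (ex_derive_continuous rho). eexists. apply rho_derive, Ht.
  - intros r Hr. assert (X := initial_radius). specialize (Hinit 0 ltac:(lra)).
    assert (D := delta_range 0 ltac:(lra)). assert (HR0 := rho_pos 0 ltac:(lra)).
    assert (0 < delta 0 * k0 * rho 0)
      by (apply Rmult_lt_0_compat; [apply Rmult_lt_0_compat|]; lra).
    assert (0 < rho 0 - eps - R0); [|lra]. apply Rmult_lt_reg_l with (1 - k0); lra.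
  - intros rs ts Hts [P1 [P2 [P3 [P4 P5]]]].
    assert (Hp := sol_pos sol).
    assert (Hle : forall t, 0 <= t <= ts -> xi t <= rho t).
    { intros t Ht. destruct (Req_dec t ts) as [->|Hne].
      - specialize (P5 0 ltac:(specialize (Hp ts ltac:(lra)); lra)). lra.
      - specialize (P4 0 t ltac:(lra) ltac:(specialize (Hp t ltac:(lra)); lra)). lra. }
    assert (xi ts < rho ts); [|lra].
    apply pinned_boundary; try assumption.
    + intros r t Ht Hr. apply Hcomp with ts; try assumption. lra.
    + apply Hinit. lra.
    + apply Hpin. lra. }
intros r t Ht Hr. split.
- specialize (Hxi r t Ht Hr). lra.
- apply Hcomp with T; try assumption; [lra|].
  intros s Hs. specialize (Hxi 0 s Hs). assert (Hp := sol_pos sol s ltac:(lra)). 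
  specialize (Hxi ltac:(lra)). lra.
Qed.
End Upper.

(** * Choice of the rates *)

Definition quart (s : R) : R := sqrt (sqrt s).

Lemma quart_pos s : 0 < s -> 0 < quart s.
Proof. intros H. apply sqrt_lt_R0, sqrt_lt_R0, H. Qed.

Lemma quart_sqr s : 0 < s -> quart s ^ 2 = sqrt s.
Proof. intros H. unfold quart. rewrite <- Rsqr_pow2. apply Rsqr_sqrt, sqrt_pos. Qed.

Lemma quart_pow4 s : 0 < s -> quart s ^ 4 = s.
Proof.
intros H. replace (quart s ^ 4) with ((quart s ^ 2) ^ 2) by ring.
rewrite quart_sqr, <- Rsqr_pow2 by exact H. apply Rsqr_sqrt. lra.
Qed.

Lemma quart_monotone x y : x <= y -> quart x <= quart y.
Proof. intros H. apply sqrt_le_1_alt, sqrt_le_1_alt, H. Qed.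

Lemma quart_derive s : 0 < s -> is_derive quart s (/ (4 * quart s ^ 3)).
Proof.
intros H. assert (Hq := quart_pos _ H). assert (Hs := sqrt_lt_R0 _ H).
unfold quart. auto_derive; [repeat split; lra|].
change (sqrt (sqrt s)) with (quart s).
rewrite <- (quart_sqr s) by exact H. field. lra.
Qed.

Lemma radius_quart P s : 0 < P -> 0 < s -> radius P s = sqrt (2 * P) * quart s ^ 2.
Proof. intros HP Hs. unfold radius. rewrite quart_sqr by exact Hs. apply sqrt_mult; lra. Qed.

Lemma pow4_lt x y : 0 < x < y -> x ^ 4 < y ^ 4.
Proof.
intros H. assert (x * x < y * y) by nra. assert (0 < x * x) by nra.
replace (x ^ 4) with (x * x * (x * x)) by ring.
replace (y ^ 4) with (y * y * (y * y)) by ring. nra.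
Qed.

Section Rates.
Variables (P s0 b e : R).
Hypothesis (HP : 0 < P) (Hs0 : 0 < s0) (Hb : 0 < b) (He : 0 < e).
Hypothesis Hbe : b * e <= quart s0.

Definition margin (t : R) : R := b * e / quart (t + s0).
Definition margin' (t : R) : R := - (b * e) / (4 * quart (t + s0) ^ 5).
(** Its derivative is [1 + margin], so that the radius below solves
    [rho rho' = P (1 + margin)]. *)
Definition outer_time (t : R) : R := t + s0 + 4 / 3 * (b * e) * quart (t + s0) ^ 3.
Definition outer_radius (t : R) : R := radius P (outer_time t).

Lemma quart_shift t : 0 <= t -> 0 < quart s0 <= quart (t + s0).
Proof. intros Ht. split; [apply quart_pos, Hs0|apply quart_monotone; lra]. Qed.

Lemma margin_range t : 0 <= t -> 0 < margin t <= 1.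
Proof.
intros Ht. assert (Q := quart_shift t Ht). unfold margin. split.
- apply Rdiv_lt_0_compat; [apply Rmult_lt_0_compat|]; lra.
- apply Rmult_le_reg_r with (quart (t + s0)); [lra|].
  replace (b * e / quart (t + s0) * quart (t + s0)) with (b * e) by (field; lra). lra.
Qed.

Lemma margin_derive t : 0 <= t -> is_derive margin t (margin' t).
Proof.
intros Ht. assert (Q := quart_shift t Ht). assert (D := quart_derive (t + s0) ltac:(lra)).
unfold margin, margin'.
auto_derive.
- split; [eexists; exact D|]. split; [|trivial]. lra.
- replace (Derive (fun x => quart x) (t + s0)) with (/ (4 * quart (t + s0) ^ 3))
    by (symmetry; apply is_derive_unique, D).
  field. lra.
Qed.

Lemma margin'_nonpos t : 0 <= t -> margin' t <= 0.
Proof.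
intros Ht. assert (Q := quart_shift t Ht). unfold margin'.
assert (0 < b * e / (4 * quart (t + s0) ^ 5)).
{ apply Rdiv_lt_0_compat; [apply Rmult_lt_0_compat; lra|].
  apply Rmult_lt_0_compat; [lra|apply pow_lt; lra]. }
unfold Rdiv in *. lra.
Qed.

Lemma margin_monotone s t : 0 <= s <= t -> margin t <= margin s.
Proof.
intros Ht. assert (Q := quart_shift s ltac:(lra)).
assert (quart (s + s0) <= quart (t + s0)) by (apply quart_monotone; lra).
apply Rmult_le_compat_l; [apply Rmult_le_pos; lra|]. apply Rinv_le_contravar; lra.
Qed.

Lemma outer_time_pos t : 0 <= t -> t + s0 <= outer_time t.
Proof.
intros Ht. assert (Q := quart_shift t Ht). unfold outer_time.
assert (0 < b * e * quart (t + s0) ^ 3).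
{ apply Rmult_lt_0_compat; [apply Rmult_lt_0_compat; lra|apply pow_lt; lra]. }
lra.
Qed.

Lemma outer_radius_pos t : 0 <= t -> 0 < outer_radius t.
Proof. intros Ht. assert (S := outer_time_pos t Ht). apply radius_pos; lra. Qed.

Lemma outer_radius_derive t : 0 <= t -> is_derive outer_radius t (P * (1 + margin t) / outer_radius t).
Proof.
intros Ht. assert (Q := quart_shift t Ht). assert (S := outer_time_pos t Ht).
apply radius_derive; [exact HP|lra|].
assert (D := quart_derive (t + s0) ltac:(lra)). unfold outer_time, margin.
auto_derive; [eexists; exact D|].
replace (Derive (fun x => quart x) (t + s0)) with (/ (4 * quart (t + s0) ^ 3))
  by (symmetry; apply is_derive_unique, D).
field. lra.
Qed.

Lemma outer_radius_monotone s t : 0 <= s <= t -> outer_radius s <= outer_radius t.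
Proof.
intros Ht. apply radius_monotone; [exact HP|]. unfold outer_time.
assert (Q := quart_shift s ltac:(lra)).
assert (quart (s + s0) <= quart (t + s0)) by (apply quart_monotone; lra).
assert (quart (s + s0) ^ 3 <= quart (t + s0) ^ 3) by (apply pow_incr; lra).
assert (b * e * quart (s + s0) ^ 3 <= b * e * quart (t + s0) ^ 3).
{ apply Rmult_le_compat_l; [apply Rmult_le_pos; lra|lra]. }
lra.
Qed.

(** From [outer_radius^2 = R^2 (1 + 4 margin / 3)] and [R <= outer_radius <= 2 R]. *)
Lemma outer_radius_gap t : 0 <= t ->
  let R := radius P (t + s0) in
  outer_radius t <= 2 * R /\ 4 / 9 * margin t * R <= outer_radius t - R <= 2 / 3 * margin t * R.
Proof.
intros Ht R. assert (Q := quart_shift t Ht). assert (S := outer_time_pos t Ht).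
assert (T := margin_range t Ht). assert (HR : 0 < R) by (apply radius_pos; lra).
assert (Hr := outer_radius_pos t Ht).
assert (E : outer_radius t * outer_radius t = R * R * (1 + 4 / 3 * margin t)).
{ unfold outer_radius, R. rewrite !radius_sqr by lra. unfold outer_time, margin.
  rewrite <- (quart_pow4 (t + s0)) at 1 3 by lra. field. lra. }
assert (H1 : R <= outer_radius t) by (apply radius_monotone; lra).
assert (HRR : 0 < R * R) by (apply Rmult_lt_0_compat; lra).
assert (H2 : outer_radius t <= 2 * R).
{ apply Rnot_lt_le. intro C.
  assert ((2 * R) * (2 * R) < outer_radius t * outer_radius t) by (apply Rmult_le_0_lt_compat; lra).
  assert (R * R * margin t <= R * R * 1) by (apply Rmult_le_compat_l; lra). lra. }
split; [exact H2|].
assert (E2 : (outer_radius t - R) * (outer_radius t + R) = 4 / 3 * margin t * R * R) by lra.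
assert (0 < margin t * R) by (apply Rmult_lt_0_compat; lra).
split.
- apply Rmult_le_reg_r with (outer_radius t + R); [lra|]. rewrite E2.
  replace (4 / 3 * margin t * R * R) with (4 / 9 * margin t * R * (3 * R)) by field.
  apply Rmult_le_compat_l; lra.
- apply Rmult_le_reg_r with (outer_radius t + R); [lra|]. rewrite E2.
  replace (4 / 3 * margin t * R * R) with (2 / 3 * margin t * R * (2 * R)) by field.
  apply Rmult_le_compat_l; lra.
Qed.

Lemma margin_radius t : 0 <= t -> margin t * radius P (t + s0) = b * e * sqrt (2 * P) * quart (t + s0).
Proof.
intros Ht. assert (Q := quart_shift t Ht). rewrite radius_quart by lra. unfold margin. field. lra.
Qed.
End Rates.

Lemma Rpower_pos x y : 0 < Rpower x y.
Proof. apply exp_pos. Qed.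

(** The exponents of the theorem: on the time scale [eps^(-4/3)] the error
    [sqrt eps * t^(1/4)] is of order [eps^(1/2 - 1/3)]. *)
Lemma quart_horizon C1 s0 eps t :
  0 < C1 -> 0 < s0 -> 0 < eps < 1 -> 0 <= t <= C1 * Rpower eps (- (4 / 3)) ->
  sqrt eps * quart (t + s0) <= quart (C1 + s0) * Rpower eps (1 / 6).
Proof.
intros HC Hs He Ht.
set (x := Rpower eps (- (1 / 3))).
assert (Hx : 0 < x) by apply Rpower_pos.
assert (E4 : x ^ 4 = Rpower eps (- (4 / 3))).
{ unfold x. rewrite <- Rpower_pow, Rpower_mult by apply Rpower_pos. f_equal. simpl. field. }
assert (H1 : 1 <= x).
{ assert (Hln : ln eps < ln 1) by (apply ln_increasing; lra). rewrite ln_1 in Hln.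
  apply Rle_trans with (1 + - (1 / 3) * ln eps); [lra|]. apply exp_ineq1_le. }
assert (Hq : quart (t + s0) <= quart (C1 + s0) * x).
{ assert (Q1 := quart_pos (C1 + s0) ltac:(lra)).
  apply Rnot_lt_le. intro C.
  assert (Q2 : (quart (C1 + s0) * x) ^ 4 < quart (t + s0) ^ 4).
  { assert (0 < quart (C1 + s0) * x) by (apply Rmult_lt_0_compat; lra).
    apply pow4_lt; lra. }
  rewrite Rpow_mult_distr, !quart_pow4 in Q2 by lra.
  assert (1 <= x ^ 4) by (apply pow_R1_Rle; exact H1).
  rewrite <- E4 in Ht. nra. }
assert (E6 : sqrt eps * x = Rpower eps (1 / 6)).
{ unfold x. rewrite <- Rpower_sqrt by lra. rewrite <- Rpower_plus. f_equal. field. }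
rewrite <- E6.
replace (quart (C1 + s0) * (sqrt eps * x)) with (sqrt eps * (quart (C1 + s0) * x)) by ring.
apply Rmult_le_compat_l; [apply sqrt_pos|exact Hq].
Qed.

(** * Upper bound and conclusion *)

(** The constants are chosen in this order: [b] makes the layer gain more than
    [eps], which does not depend on [eps] because both sides are proportional to
    it; then [e0] makes [margin <= 1] and [eps] small compared with [margin * R]. *)
Lemma upper_bound N k0 P F p q s0 :
  extended_profile N k0 P F p q -> 0 < s0 ->
  exists b e0, 0 < b /\ 0 < e0 /\
  forall eps k u0 du0 xi u ur urr ut,
  0 < eps -> sqrt eps <= e0 ->
  periodic eps k -> is_minimum k k0 ->
  admissible k (xi 0) u0 du0 ->
  (forall r, 0 <= r <= xi 0 -> r <= radius P s0 -> u0 r <= dilate F (radius P s0) r) ->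
  solution N k u0 xi u ur urr ut ->
  forall t r, 0 <= t -> 0 <= r <= xi t -> r <= radius P (t + s0) ->
  u r t <= dilate F (radius P (t + s0)) r + b * (sqrt eps * quart (t + s0)) + eps.
Proof.
intros HF Hs0. pose proof HF as [_ [Hk0 Hk1] HP _ _ _ _ _ _ _ _ _].
assert (HN' := dim_minus_one_nonneg HF).
set (g := sqrt (2 * P)). assert (Hg : 0 < g) by (apply sqrt_lt_R0; lra).
set (y0 := quart s0). assert (Hy0 : 0 < y0) by (apply quart_pos, Hs0).
set (K := 2 * INR N + 16 * P).
set (c := (1 - k0) / 9 * k0). assert (Hc : 0 < c) by (apply Rmult_lt_0_compat; lra).
assert (Hcg : 0 < c ^ 2 * g) by (apply Rmult_lt_0_compat; [apply pow_lt|]; lra).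
set (b := 1 + 32 * K / (c ^ 2 * g)).
assert (HK : 0 < K) by (unfold K; lra).
assert (Hb0 : 0 < 32 * K / (c ^ 2 * g)) by (apply Rdiv_lt_0_compat; lra).
assert (Hb : 1 < b) by (unfold b; lra).
assert (HbK : 32 * K < c ^ 2 * g * b ^ 2).
{ apply Rlt_le_trans with (c ^ 2 * g * b).
  - replace (c ^ 2 * g * b) with (c ^ 2 * g + 32 * K) by (unfold b; field; lra). lra.
  - apply Rmult_le_compat_l; [lra|]. nra. }
exists (2 / 3 * (b * g)), (Rmin (y0 / b) (2 / 9 * (b * g) * y0)).
assert (Hbg : 0 < b * g) by (apply Rmult_lt_0_compat; lra).
split; [lra|]. split.
{ apply Rmin_glb_lt; [apply Rdiv_lt_0_compat; lra|].
  apply Rmult_lt_0_compat; lra. }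
intros eps k u0 du0 xi u ur urr ut Heps Hsmall kper kmin adm init sol t r Ht Hr HrR.
set (e := sqrt eps) in *.
assert (He : 0 < e) by (apply sqrt_lt_R0, Heps).
assert (Hee : e * e = eps) by (apply sqrt_sqrt; lra).
assert (m1 := Rmin_l (y0 / b) (2 / 9 * (b * g) * y0)).
assert (m2 := Rmin_r (y0 / b) (2 / 9 * (b * g) * y0)).
assert (Hbe : b * e <= quart s0).
{ fold y0. replace y0 with (b * (y0 / b)) by (field; lra). apply Rmult_le_compat_l; lra. }
assert (Hb' : 0 < b) by lra.
assert (Heg : forall s, 0 <= s -> eps <= 2 / 9 * (margin s0 b e s * radius P (s + s0))).
{ intros s Hs. rewrite margin_radius by assumption. fold g.
  assert (Q := quart_shift s0 Hs0 s Hs). fold y0 in Q. rewrite <- Hee.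
  replace (2 / 9 * (b * e * g * quart (s + s0))) with (e * (2 / 9 * (b * g) * quart (s + s0))) by field.
  apply Rmult_le_compat_l; [lra|]. apply Rle_trans with (2 / 9 * (b * g) * y0); [lra|].
  apply Rmult_le_compat_l; lra. }
assert (HR0 : 0 < radius P s0) by (apply radius_pos; lra).
assert (Trk := tracking HF sol adm (radius P s0) (outer_radius P s0 b e) (margin s0 b e) (margin' s0 b e)
  HR0 init (outer_radius_pos P s0 b e HP Hs0 Hb' He) (outer_radius_derive P s0 b e HP Hs0 Hb' He)
  (outer_radius_monotone P s0 b e HP Hs0 Hb' He) (margin_range s0 b e Hs0 Hb' He Hbe)
  (margin_derive s0 b e Hs0) (margin'_nonpos s0 b e Hs0 Hb' He) (margin_monotone s0 b e Hs0 Hb' He)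
  eps Heps kper kmin t Ht).
destruct (Trk) with (r := r) (t := t) as [T1 T2].
- intros s Hs. unfold slope_excess. destruct (outer_radius_gap P s0 b e HP Hs0 Hb' He Hbe s ltac:(lra)) as [G1 G2].
  specialize (Heg s ltac:(lra)). set (R := radius P (s + s0)) in *.
  assert (HR : radius P s0 <= R) by (apply radius_monotone; lra).
  assert (Hth := margin_range s0 b e Hs0 Hb' He Hbe s ltac:(lra)).
  replace ((1 - k0) / 9 * margin s0 b e s * k0 * outer_radius P s0 b e s) with
    ((1 - k0) * (margin s0 b e s * (k0 * outer_radius P s0 b e s) / 9)) by field.
  apply Rmult_le_compat_l; [lra|].
  assert (margin s0 b e s * (k0 * outer_radius P s0 b e s) <= margin s0 b e s * (2 * R)).
  { apply Rmult_le_compat_l; [lra|]. nra. }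
  lra.
- intros s Hs. unfold slope_excess. destruct (outer_radius_gap P s0 b e HP Hs0 Hb' He Hbe s ltac:(lra)) as [G1 G2].
  specialize (Heg s ltac:(lra)).
  assert (ER := radius_quart P (s + s0) HP ltac:(lra)). fold g in ER.
  set (R := radius P (s + s0)) in *.
  assert (Q := quart_shift s0 Hs0 s ltac:(lra)).
  assert (Hth := margin_range s0 b e Hs0 Hb' He Hbe s ltac:(lra)).
  assert (HR : 0 < R) by (apply radius_pos; lra).
  assert (0 < margin s0 b e s * R) by (apply Rmult_lt_0_compat; lra).
  fold K.
  apply Rlt_le_trans with (((1 - k0) / 9 * margin s0 b e s * k0) ^ 2 * R).
  + replace (((1 - k0) / 9 * margin s0 b e s * k0) ^ 2 * R) with (c ^ 2 * g * b ^ 2 * eps).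
    * apply Rmult_lt_compat_r; lra.
    * rewrite ER, <- Hee. unfold margin, c. field. lra.
  + apply Rmult_le_compat_l; [apply pow2_ge_0|lra].
- lra.
- exact Hr.
- destruct (outer_radius_gap P s0 b e HP Hs0 Hb' He Hbe t Ht) as [G1 G2].
  assert (Hth := margin_range s0 b e Hs0 Hb' He Hbe t Ht).
  assert (Hrho := outer_radius_pos P s0 b e HP Hs0 Hb' He t Ht).
  assert (S := stretched_le_dilate HF (outer_radius P s0 b e t) (slope_excess k0 (margin s0 b e) t) r Hrho
    ltac:(unfold slope_excess; apply Rmult_le_pos; lra) ltac:(lra)).
  assert (HR : 0 < radius P (t + s0)) by (apply radius_pos; lra).
  assert (0 < margin s0 b e t * radius P (t + s0)) by (apply Rmult_lt_0_compat; lra).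
  assert (D := profile_dilation HF (radius P (t + s0)) (outer_radius P s0 b e t) r ltac:(lra) ltac:(lra)).
  fold (dilate F (outer_radius P s0 b e t) r) (dilate F (radius P (t + s0)) r) in D.
  assert (E := margin_radius P s0 b e HP Hs0 t Ht). fold g in E.
  replace (2 / 3 * (b * g) * (e * quart (t + s0))) with
    (2 / 3 * (margin s0 b e t * radius P (t + s0))) by (rewrite E; field).
  lra.
Qed.


Theorem theorem1p3 :
  forall (N : nat) (k0 k1 t0 s0 P : R) (Phi : R -> R)
         (k u0 du0 xi : R -> R -> R) (u : R -> R -> R -> R),
  (1 <= N)%nat ->
  0 < k0 -> k0 <= k1 -> k1 < 1 ->
  0 < t0 -> t0 < s0 ->
  profile N k0 P Phi ->
  (forall eps, 0 < eps ->
     smooth (k eps) /\ periodic eps (k eps) /\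
     is_minimum (k eps) k0 /\ is_maximum (k eps) k1) ->
  (forall eps, 0 < eps ->
     admissible (k eps) (xi eps 0) (u0 eps) (du0 eps) /\
     (forall r, 0 <= r <= xi eps 0 -> 0 <= du0 eps r) /\
     (forall r, 0 <= r <= xi eps 0 -> r <= sqrt (2 * P * t0) ->
        selfsim P Phi t0 r <= u0 eps r) /\
     (forall r, 0 <= r <= xi eps 0 -> r <= sqrt (2 * P * s0) ->
        u0 eps r <= selfsim P Phi s0 r)) ->
  (forall eps, 0 < eps ->
     classical_solution N (k eps) (u0 eps) (xi eps) (u eps)) ->
  forall C1, 0 < C1 ->
  exists eps0 C2, 0 < eps0 /\ 0 < C2 /\
  forall eps, 0 < eps < eps0 ->
  forall t, 0 <= t <= C1 * Rpower eps (- (4 / 3)) ->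
    (forall r, 0 <= r <= xi eps t -> r <= sqrt (2 * P * (t + t0)) ->
       selfsim P Phi (t + t0) r <= u eps r t) /\
    (forall r, 0 <= r <= xi eps t -> r <= sqrt (2 * P * (t + s0)) ->
       u eps r t <= selfsim P Phi (t + s0) r + C2 * Rpower eps (1 / 6)).
Proof.
intros N k0 k1 t0 s0 P Phi k u0 du0 xi u HN Hk0 Hk01 Hk1 Ht0 Hts Hprof Hk Hinit Hsol C1 HC1.
destruct (profile_extension N k0 P Phi HN ltac:(lra) Hprof) as [F [p [q [HF EF]]]].
assert (HP := profile_P HF).
assert (Esim : forall s r, 0 < s -> 0 <= r <= radius P s ->
  selfsim P Phi s r = dilate F (radius P s) r).
{ intros s r Hs Hr. unfold selfsim, dilate. fold (radius P s). rewrite EF; [reflexivity|].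
  apply ratio_inside_closed; [exact Hr|apply radius_pos; lra]. }
destruct (upper_bound N k0 P F p q s0 HF ltac:(lra)) as [b [e0 [Hb [He0 Hup]]]].
assert (Q := quart_pos (C1 + s0) ltac:(lra)).
exists (Rmin 1 (e0 ^ 2)), (b * quart (C1 + s0) + 1).
assert (Hbq : 0 < b * quart (C1 + s0)) by (apply Rmult_lt_0_compat; lra).
split; [apply Rmin_glb_lt; [lra|apply pow_lt, He0]|]. split; [lra|].
intros eps Heps t Ht.
assert (m1 := Rmin_l 1 (e0 ^ 2)). assert (m2 := Rmin_r 1 (e0 ^ 2)).
destruct (Hk eps ltac:(lra)) as [_ [kper [kmin _]]].
destruct (Hinit eps ltac:(lra)) as [adm [_ [ilow iup]]].
destruct (classical_solution_data _ _ _ _ _ (Hsol eps ltac:(lra))) as [ur [urr [ut sol]]].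
split; intros r Hr HrR.
- rewrite Esim by (unfold radius; lra).
  apply (lower_bound HF t0 Ht0 (k eps) (u0 eps) (du0 eps) (xi eps) (u eps) ur urr ut sol adm);
    try assumption.
  + apply kmin.
  + intros x Hx HxR. rewrite <- Esim by lra. apply ilow; assumption.
  + lra.
- rewrite Esim by (unfold radius; lra).
  assert (Hse : sqrt eps <= e0).
  { rewrite <- (sqrt_pow2 e0) by lra. apply sqrt_le_1_alt. lra. }
  assert (B := Hup eps (k eps) (u0 eps) (du0 eps) (xi eps) (u eps) ur urr ut ltac:(lra) Hse kper kmin adm).
  assert (B' := B ltac:(intros x Hx HxR; rewrite <- Esim by lra; apply iup; assumption)
     sol t r ltac:(lra) Hr HrR).
  assert (Hq := quart_horizon C1 s0 eps t HC1 ltac:(lra) ltac:(lra) Ht).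
  assert (b * (sqrt eps * quart (t + s0)) <= b * (quart (C1 + s0) * Rpower eps (1 / 6)))
    by (apply Rmult_le_compat_l; lra).
  assert (eps <= Rpower eps (1 / 6)).
  { rewrite <- (Rpower_1 eps) at 1 by lra. unfold Rpower.
    assert (Hln : ln eps < ln 1) by (apply ln_increasing; lra). rewrite ln_1 in Hln.
    left. apply exp_increasing. lra. }
  lra.
Qed.
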